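(* For all integers $m,d\ge 1$, $$2^{-2(d-1)}\, m^{\frac{d-1}{2}}\le C'(m,d)\le C(m,d)\le m^{\frac{d-1}{2}},$$ where $C(m,d)$ and $C'(m,d)$ are the factorization constants defined in the context.
   Context: Write $[m]=\{1,\dots,m\}$. For scalars $\lambda=\{\lambda_i\in\mathbb{C}\mid i=(i_1,\dots,i_d)\in[m]^d\}$ define $$|||\lambda|||=\sup\Big\|\sum_{i\in[m]^d}\lambda_i\, x^1_{i_1}x^2_{i_2}\cdots x^d_{i_d}\Big\|_{B(\ell_2)},$$ where the supremum runs over all families $\{x^k_j\mid 1\le k\le d,\ 1\le j\le m\}$ in the unit ball of $B(\ell_2)$. For a family $\{x_i\mid i\in[m]^d\}$ in $B(\ell_2)$ and a constant $C\ge 0$, consider the property (F$_C$): there are operators $\{x^k_p\mid 1\le k\le d,\ 1\le p\le m\}$ in the unit ball of $B(\ell_2)$ such that $x_i=C\,x^1_{i_1}x^2_{i_2}\cdots x^d_{i_d}$ for all $i\in[m]^d$. $C(m,d)$ is the smallest constant $C\ge0$ such that every family $\{x_i\mid i\in[m]^d\}$ in $B(\ell_2)$ satisfying $\|\sum\lambda_i x_i\|\le|||\lambda|||$ for all scalar families $(\lambda_i)$ has property (F$_C$). $C'(m,d)$ is the smallest constant $C\ge 0$ such that every family $\{x_i\mid i\in[m]^d\}$ in $B(\ell_2)$ satisfying $\|\sum\lambda_i x_i\|\le(\sum|\lambda_i|^2)^{1/2}$ for all scalar families $(\lambda_i)$ has property (F$_C$). *)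

(* Defs.v *)
From HB Require Import structures.
From mathcomp Require Import all_boot all_order all_algebra.
From mathcomp Require Import complex.
From mathcomp Require Import all_classical all_reals.
From mathcomp Require Import ereal topology normedtype sequences exp.
From mathcomp Require Import ring lra.

Set Implicit Arguments.
Unset Strict Implicit.
Unset Printing Implicit Defensive.

Import Order.TTheory GRing.Theory Num.Theory.
Import Normc numFieldNormedType.Exports.

Local Open Scope classical_set_scope.
Local Open Scope ring_scope.
Local Open Scope complex_scope.

Section Ell2.
Context (R : realType).

Lemma normC_normc (z : R[i]) : `|z| = (normc z)%:C.
Proof. by []. Qed.

Lemma normc_ge0 (z : R[i]) : 0 <= normc z.
Proof. by case: z => a b; exact: sqrtr_ge0. Qed.

Lemma normc_triangle (y z : R[i]) : normc (y + z) <= normc y + normc z.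
Proof. by have := ler_normD y z; rewrite !normC_normc -rmorphD /= lecR. Qed.

Definition sqsum (u : nat -> R[i]) : R^nat := series (fun n => normc (u n) ^+ 2).

Definition square_summable : {pred nat -> R[i]} := mem [set u | cvgn (sqsum u)].

Lemma square_summableP u : reflect (cvgn (sqsum u)) (u \in square_summable).
Proof. by apply: (iffP idP); rewrite inE. Qed.

Lemma sqsum_nd u : nondecreasing_seq (sqsum u).
Proof. by apply: nondecreasing_series => n _ _; rewrite exprn_ge0 ?normc_ge0. Qed.

Lemma square_summable_submod_closed : submod_closed square_summable.
Proof.
split.
  apply/square_summableP; rewrite (_ : sqsum 0 = cst 0); first exact: is_cvg_cst.
  apply/funext => n; rewrite /sqsum /series /= big1// => k _.
  by rewrite expr0n/= addr0 sqrtr0 expr0n.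
move=> a u v /square_summableP uS /square_summableP vS; apply/square_summableP.
have := is_cvg_seriesD (is_cvg_seriesZ (k := 2 * normc a ^+ 2) uS)
  (is_cvg_seriesZ (k := 2) vS).
apply: series_le_cvg => n.
- by rewrite exprn_ge0 ?normc_ge0.
- by rewrite /= addr_ge0// mulr_ge0// ?mulr_ge0 ?exprn_ge0 ?normc_ge0.
- rewrite /= (_ : (a *: u + v) n = a * u n + v n)//.
  have h := normc_triangle (a * u n) (v n).
  have n0 := normc_ge0 (a * u n + v n).
  apply: (@le_trans _ _ ((normc (a * u n) + normc (v n)) ^+ 2)).
    by rewrite lerXn2r// nnegrE addr_ge0 ?normc_ge0.
  rewrite normcM.
  set x := normc a * normc (u n); set y := normc (v n).
  rewrite -subr_ge0 [X in 0 <= X](_ : _ = (x - y) ^+ 2) ?sqr_ge0//.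
  rewrite [LHS](_ : _ = 2 * normc a ^+ 2 * normc (u n) ^+ 2 + 2 * y ^+ 2
                        - (x + y) ^+ 2)//.
  by rewrite /x; ring.
Qed.

HB.instance Definition _ :=
  GRing.isSubmodClosed.Build R[i] (nat -> R[i]) square_summable
    square_summable_submod_closed.

Record ell2 := Ell2 {
  ell2_val :> nat -> R[i];
  ell2_valP : ell2_val \in square_summable }.

HB.instance Definition _ := [isSub for ell2_val].
HB.instance Definition _ := [Choice of ell2 by <:].
HB.instance Definition _ := [SubChoice_isSubLmodule of ell2 by <:].

Definition l2norm (u : ell2) : R := Num.sqrt (limn (sqsum u)).

Lemma sqsum_cvg (u : ell2) : cvgn (sqsum u).
Proof. exact/square_summableP/ell2_valP. Qed.

Lemma l2norm_ge0 (u : ell2) : 0 <= l2norm u.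
Proof. exact: sqrtr_ge0. Qed.

Lemma lim_sqsum_ge0 (u : ell2) : 0 <= limn (sqsum u).
Proof.
have := nondecreasing_cvgn_le (@sqsum_nd u) (@sqsum_cvg u) 0%N.
by rewrite /sqsum /series /= big_geq.
Qed.

Lemma sqr_l2norm (u : ell2) : l2norm u ^+ 2 = limn (sqsum u).
Proof. by rewrite sqr_sqrtr// lim_sqsum_ge0. Qed.

Lemma sqsum_le (u : ell2) n : sqsum u n <= l2norm u ^+ 2.
Proof.
rewrite sqr_l2norm.
exact: (nondecreasing_cvgn_le (@sqsum_nd u) (@sqsum_cvg u)).
Qed.

Lemma l2norm_le (u : ell2) c : 0 <= c ->
  (forall n, sqsum u n <= c ^+ 2) -> l2norm u <= c.
Proof.
move=> c0 uc; rewrite -(@ler_pXn2r _ 2)// ?nnegrE ?l2norm_ge0// sqr_l2norm.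
by apply: limr_le; [exact: sqsum_cvg | apply: nearW].
Qed.

Lemma normc_le_l2norm (u : ell2) n : normc (u n) <= l2norm u.
Proof.
rewrite -(@ler_pXn2r _ 2)// ?nnegrE ?l2norm_ge0 ?normc_ge0//.
apply: le_trans (sqsum_le u n.+1).
rewrite /sqsum /series /= big_nat_recr//= lerDr.
by apply: sumr_ge0 => k _; rewrite exprn_ge0 ?normc_ge0.
Qed.

Lemma ell2P (u v : ell2) : (forall n, u n = v n) -> u = v.
Proof. by move=> uv; apply/val_inj/funext. Qed.

Lemma l2norm0_eq0 (u : ell2) : l2norm u = 0 -> u = 0.
Proof.
move=> u0; apply: ell2P => n; apply: eq0_normc.
by apply/eqP; rewrite eq_le normc_ge0 andbT -u0 normc_le_l2norm.
Qed.

Lemma l2normZ a (u : ell2) : l2norm (a *: u) = normc a * l2norm u.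
Proof.
have aS n : sqsum (a *: u) n = normc a ^+ 2 * sqsum u n.
  rewrite /sqsum /series /= big_distrr/=; apply: eq_bigr => k _.
  by rewrite -exprMn -normcM.
apply/eqP; rewrite eq_le; apply/andP; split.
  apply: l2norm_le => [|n]; first by rewrite mulr_ge0 ?normc_ge0 ?l2norm_ge0.
  by rewrite aS exprMn ler_wpM2l ?exprn_ge0 ?normc_ge0// sqsum_le.
have [->|a0] := eqVneq (normc a) 0; first by rewrite mul0r l2norm_ge0.
have {}a0 : 0 < normc a by rewrite lt_def a0 normc_ge0.
rewrite mulrC -ler_pdivlMr//; apply: l2norm_le => [|n].
  by rewrite divr_ge0 ?l2norm_ge0// ltW.
rewrite expr_div_n ler_pdivlMr ?exprn_gt0// mulrC -aS.
exact: sqsum_le.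
Qed.

Lemma l2norm0 : l2norm 0 = 0.
Proof. by rewrite -(scale0r 0) l2normZ normc0 mul0r. Qed.

Lemma ler_l2normD (u v : ell2) : l2norm (u + v) <= l2norm u + l2norm v.
Proof.
have [/eqP/l2norm0_eq0 ->|u0] := boolP (l2norm u == 0).
  by rewrite add0r l2norm0 add0r.
have [/eqP/l2norm0_eq0 ->|v0] := boolP (l2norm v == 0).
  by rewrite addr0 l2norm0 addr0.
have {}u0 : 0 < l2norm u by rewrite lt_def u0 l2norm_ge0.
have {}v0 : 0 < l2norm v by rewrite lt_def v0 l2norm_ge0.
apply: l2norm_le => [|n]; first by rewrite addr_ge0 ?l2norm_ge0.
set p := l2norm u in u0 *; set q := l2norm v in v0 *.
have pq : 0 < p + q by rewrite addr_gt0.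
apply: (@le_trans _ _ ((p + q) / p * sqsum u n + (p + q) / q * sqsum v n)).
  rewrite /sqsum /series /= !big_distrr/= -big_split/=.
  apply: ler_sum => k _.
  have h : normc (u k + v k) <= _ := normc_triangle (u k) (v k).
  apply: (@le_trans _ _ ((normc (u k) + normc (v k)) ^+ 2)).
    by rewrite lerXn2r// nnegrE ?addr_ge0 ?normc_ge0.
  set x := normc (u k); set y := normc (v k).
  rewrite -subr_ge0 [X in 0 <= X](_ : _ = (x * q - y * p) ^+ 2 / (p * q)).
    by rewrite divr_ge0 ?sqr_ge0// mulr_ge0// ltW.
  by field; rewrite !gt_eqF.
apply: (@le_trans _ _ ((p + q) / p * p ^+ 2 + (p + q) / q * q ^+ 2)).
  by apply: lerD; apply: ler_wpM2l; rewrite ?divr_ge0 ?(ltW u0) ?(ltW v0) ?(ltW pq)//; exact: sqsum_le.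
by rewrite le_eqVlt; apply/orP; left; apply/eqP; field; rewrite !gt_eqF.
Qed.

Lemma l2norm_complexD (u v : ell2) :
  (l2norm (u + v))%:C <= (l2norm u)%:C + (l2norm v)%:C.
Proof. by rewrite -rmorphD/= lecR ler_l2normD. Qed.

Lemma l2norm_complexZ a (u : ell2) : (l2norm (a *: u))%:C = `|a| * (l2norm u)%:C.
Proof. by rewrite l2normZ rmorphM. Qed.

Lemma l2norm_complex_eq0 (u : ell2) : (l2norm u)%:C = 0 -> u = 0.
Proof. by move=> [] /l2norm0_eq0. Qed.

HB.instance Definition _ := Lmodule_isNormed.Build R[i] ell2
  l2norm_complexD l2norm_complexZ l2norm_complex_eq0.

Lemma ell2_normE (u : ell2) : `|u| = (l2norm u)%:C.
Proof. by []. Qed.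

Definition bounded_operator : {pred ell2 -> ell2} :=
  mem [set T | linear T /\ continuous T].

Lemma bounded_operatorP T :
  reflect (linear T /\ continuous T) (T \in bounded_operator).
Proof. by apply: (iffP idP); rewrite inE. Qed.

Lemma bounded_operator_submod_closed : submod_closed bounded_operator.
Proof.
split.
  apply/bounded_operatorP; split; last exact: cst_continuous.
  by move=> a u v; rewrite /GRing.zero/= scaler0 addr0.
move=> a S T /bounded_operatorP[lS cS] /bounded_operatorP[lT cT].
apply/bounded_operatorP; split.
  move=> b u v; change (a *: S (b *: u + v) + T (b *: u + v) =
    b *: (a *: S u + T u) + (a *: S v + T v)).
  by rewrite lS lT !scalerDr !scalerA [b * a]mulrC addrACA.
by move=> u; have := cvgD (cvgZr (k := a) (cS u)) (cT u); apply.
Qed.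

HB.instance Definition _ :=
  GRing.isSubmodClosed.Build R[i] (ell2 -> ell2) bounded_operator
    bounded_operator_submod_closed.

(* $B(\ell_2)$ *)
Record bop := Bop {
  bop_fun :> ell2 -> ell2;
  bop_funP : bop_fun \in bounded_operator }.

HB.instance Definition _ := [isSub for bop_fun].
HB.instance Definition _ := [Choice of bop by <:].
HB.instance Definition _ := [SubChoice_isSubLmodule of bop by <:].

Lemma bop_linear (T : bop) : linear T.
Proof. by have /bounded_operatorP[] := bop_funP T. Qed.

Lemma bop_continuous (T : bop) : continuous T.
Proof. by have /bounded_operatorP[] := bop_funP T. Qed.

HB.instance Definition _ (T : bop) :=
  GRing.isLinear.Build R[i] ell2 ell2 *:%R T (@bop_linear T).

Lemma bopP (S T : bop) : (forall u, S u = T u) -> S = T.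
Proof. by move=> ST; apply/val_inj/funext. Qed.

Lemma bop_id_subproof : idfun \in bounded_operator.
Proof. by apply/bounded_operatorP; split => // u; exact: cvg_id. Qed.

Lemma bop_comp_subproof (S T : bop) : S \o T \in bounded_operator.
Proof.
apply/bounded_operatorP; split => [a u v /=|]; first by rewrite !linearP.
by move=> u; apply: continuous_comp; exact: bop_continuous.
Qed.

Definition bop_one := Bop bop_id_subproof.
Definition bop_mul (S T : bop) := Bop (bop_comp_subproof S T).

Lemma bop_mulA : associative bop_mul.
Proof. by move=> S T U; exact: bopP. Qed.

Lemma bop_mul1l : left_id bop_one bop_mul.
Proof. by move=> S; exact: bopP. Qed.

Lemma bop_mul1r : right_id bop_one bop_mul.
Proof. by move=> S; exact: bopP. Qed.

Lemma bop_mulDl : left_distributive bop_mul +%R.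
Proof. by move=> S T U; exact: bopP. Qed.

Lemma bop_mulDr : right_distributive bop_mul +%R.
Proof. by move=> S T U; apply: bopP => u; exact: raddfD. Qed.

HB.instance Definition _ := GRing.Zmodule_isPzRing.Build bop
  bop_mulA bop_mul1l bop_mul1r bop_mulDl bop_mulDr.

Lemma bop_mulE (S T : bop) u : (S * T) u = S (T u).
Proof. by []. Qed.

Definition opnorm (T : bop) : R :=
  sup [set l2norm (T u) | u in [set u | l2norm u <= 1]].

Lemma opnorm_has_sup (T : bop) :
  has_sup [set l2norm (T u) | u in [set u | l2norm u <= 1]].
Proof.
split; first by exists (l2norm (T 0)); exists 0 => //=; rewrite l2norm0.
have /linear_bounded_continuous/linear_boundedP := @bop_continuous T.
move=> /pinfty_ex_gt0[M M0 TM].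
have MR : M = (complex.Re M)%:C.
  by rewrite RRe_real// realE ltW.
have {}M0 : 0 <= complex.Re M by rewrite -lecR -MR ltW.
exists (complex.Re M) => _ [u /= u1 <-].
have := TM u; rewrite !ell2_normE MR -rmorphM lecR/= => /le_trans; apply.
by rewrite ler_piMr.
Qed.

Lemma opnorm_ub (T : bop) (u : ell2) : l2norm u <= 1 -> l2norm (T u) <= opnorm T.
Proof. by move=> u1; apply: sup_upper_bound (opnorm_has_sup T) _ _; exists u. Qed.

Lemma opnorm_ge0 (T : bop) : 0 <= opnorm T.
Proof.
by apply: le_trans (opnorm_ub T (u := 0) _); rewrite ?l2norm_ge0// l2norm0.
Qed.

Lemma opnorm_le (T : bop) (c : R) :
  (forall u : ell2, l2norm u <= 1 -> l2norm (T u) <= c) -> opnorm T <= c.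
Proof.
move=> Tc; apply: ge_sup; first by case: (opnorm_has_sup T).
by move=> _ [u u1 <-]; exact: Tc.
Qed.

Lemma l2norm_opnorm (T : bop) (u : ell2) : l2norm (T u) <= opnorm T * l2norm u.
Proof.
have [/eqP/l2norm0_eq0 ->|u0] := boolP (l2norm u == 0).
  by rewrite raddf0 l2norm0 mulr0.
have {}u0 : 0 < l2norm u by rewrite lt_def u0 l2norm_ge0.
have nE : normc ((l2norm u)^-1)%:C = (l2norm u)^-1.
  by rewrite /= expr0n/= addr0 sqrtr_sqr ger0_norm// invr_ge0 ltW.
have := opnorm_ub T (u := ((l2norm u)^-1)%:C *: u).
rewrite linearZ/= !l2normZ nE mulVf ?gt_eqF// lexx => /(_ isT).
by rewrite ler_pdivrMl// mulrC.
Qed.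

Lemma opnorm0 : opnorm 0 = 0.
Proof.
apply/eqP; rewrite eq_le opnorm_ge0 andbT.
by apply: opnorm_le => u _; rewrite [X in l2norm X](_ : _ = 0) ?l2norm0.
Qed.

Lemma opnorm1_le1 : opnorm 1 <= 1.
Proof. by apply: opnorm_le. Qed.

Lemma ler_opnormD (S T : bop) : opnorm (S + T) <= opnorm S + opnorm T.
Proof.
apply: opnorm_le => u u1; apply: le_trans (ler_l2normD (S u) (T u)) _.
by apply: lerD; exact: opnorm_ub.
Qed.

Lemma ler_opnormZ a (T : bop) : opnorm (a *: T) <= normc a * opnorm T.
Proof.
apply: opnorm_le => u u1; rewrite [X in l2norm X](_ : _ = a *: T u)// l2normZ.
by rewrite ler_wpM2l ?normc_ge0// opnorm_ub.
Qed.

Lemma ler_opnormM (S T : bop) : opnorm (S * T) <= opnorm S * opnorm T.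
Proof.
apply: opnorm_le => u u1; apply: le_trans (l2norm_opnorm S (T u)) _.
by rewrite ler_wpM2l ?opnorm_ge0// opnorm_ub.
Qed.

Section Factorization.
Context (m d : nat).

(* The multi-indices of $[m]^d$ are the functions {ffun 'I_d -> 'I_m}; the
   product over k : 'I_d is composition in bop, in increasing order of k. *)
Definition unit_family (x : 'I_d -> 'I_m -> bop) : Prop :=
  forall k j, opnorm (x k j) <= 1.

Definition word (x : 'I_d -> 'I_m -> bop) (i : {ffun 'I_d -> 'I_m}) : bop :=
  \prod_(k < d) x k (i k).

Definition triple_norm (lambda : {ffun 'I_d -> 'I_m} -> R[i]) : R :=
  sup [set opnorm (\sum_i lambda i *: word x i) | x in unit_family].

Lemma opnorm_word_le1 x i : unit_family x -> opnorm (word x i) <= 1.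
Proof.
move=> x1; rewrite /word; elim/big_ind : _ => [|S T S1 T1|k _].
- exact: opnorm1_le1.
- apply: le_trans (ler_opnormM S T) _.
  by rewrite mulr_ile1 ?opnorm_ge0.
- exact: x1.
Qed.

Lemma triple_norm_has_sup (lambda : {ffun 'I_d -> 'I_m} -> R[i]) :
  has_sup [set opnorm (\sum_i lambda i *: word x i) | x in unit_family].
Proof.
split.
  by eexists; exists (fun _ _ => 0) => // k j; rewrite opnorm0 ler01.
exists (\sum_i normc (lambda i)) => _ [x x1 <-].
apply: (big_ind2 (fun S a => opnorm S <= a)) => [|S a T b Sa Tb|i _].
- by rewrite opnorm0.
- by apply: le_trans (ler_opnormD S T) _; exact: lerD.
- apply: le_trans (ler_opnormZ _ _) _.
  by rewrite ler_piMr ?normc_ge0// opnorm_word_le1.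
Qed.

Definition factorizes (C : R) (x : {ffun 'I_d -> 'I_m} -> bop) : Prop :=
  exists y : 'I_d -> 'I_m -> bop,
    unit_family y /\ forall i, x i = C%:C *: word y i.

Definition triple_norm_dominated (x : {ffun 'I_d -> 'I_m} -> bop) : Prop :=
  forall lambda : {ffun 'I_d -> 'I_m} -> R[i],
    opnorm (\sum_i lambda i *: x i) <= triple_norm lambda.

Definition l2_dominated (x : {ffun 'I_d -> 'I_m} -> bop) : Prop :=
  forall lambda : {ffun 'I_d -> 'I_m} -> R[i],
    opnorm (\sum_i lambda i *: x i) <= Num.sqrt (\sum_i normc (lambda i) ^+ 2).

(* The infimum is taken in \bar R, so that it is +oo when no constant is
   admissible. *)
Definition factorization_constant : \bar R :=
  ereal_inf [set C%:E | C in
    [set C : R | 0 <= C /\ forall x, triple_norm_dominated x -> factorizes C x]].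

Definition factorization_constant' : \bar R :=
  ereal_inf [set C%:E | C in
    [set C : R | 0 <= C /\ forall x, l2_dominated x -> factorizes C x]].

End Factorization.
End Ell2.

(* Main.v *)
From HB Require Import structures.
Require Import Defs.
From mathcomp Require Import all_boot all_order all_algebra.
From mathcomp Require Import all_fingroup all_solvable all_field complex.
From mathcomp Require Import all_classical all_reals.
From mathcomp Require Import ereal topology normedtype sequences exp.
From mathcomp Require Import ring lra zify.

(** The upper estimates are soft.  Let V_1, ..., V_m be isometries of $\ell_2$
   with orthogonal ranges and write V_i for the product along a multi-index i.
   The V_i map a unit vector to orthonormal vectors, so $|||\lambda|||$ is at
   least the $\ell_2$ norm of $\lambda$ ([l2_le_triple_norm]); hence every
   $\ell_2$-dominated family is dominated by $|||\cdot|||$ and C' <= C.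
   The members of a dominated family are contractions, and every family of
   contractions factors with constant A := $m^{(d-1)/2}$: since V_w^* V_w' is 1 or
   0 according as w = w' or not,
     x_(j, w) = A * (A^-1 sum_w' x_(j, w') V_w'^* ) * V_w,
   and the first factor is a contraction by Cauchy-Schwarz, because
   sum_w |V_w^* u|^2 <= |u|^2 ([factorizes_contractions]).

   For the lower estimate take involutions s_(k, j), for k in [d] and j in [m],
   of a set of N points, let U_i be the product along i of the corresponding
   permutation matrices, and let phi(i) be the product over k of
   w^(i_k i_(k+1)), with w a primitive m-th root of unity.  The family is
     x_i = conj(phi(i)) U_i Q / c,
   where Q is close to the identity in normalized trace.  Suppose x_i = C y_i
   with y_i a word in contractions.  The sum over i of phi(i) tr(x_i U_i^-1) is
   m^d tr(Q) / c.  On the other hand tr(y_i U_i^-1) is a coefficient of a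
   product of the contractions (v_a)_a |-> (y^k_j v_(s_(k, j) a))_a acting on
   families of vectors, so that the sum over i alternates contractions
   with d-1 Fourier matrices, each of norm $\sqrt m$; it is at most
   $m^{(d+1)/2} N$ ([phase_sum_le]).  Therefore C >= A * (tr(Q) / N) / c.

   It remains to make the x_i $\ell_2$-dominated with c close to d+1
   ([truncation]).  If the involutions were free, acting on the reduced words,
   Haagerup's inequality would say that T_z := sum_i z_i U_i has norm at most
   (d+1) |z|: each letter is the sum of a creation and an annihilation operator,
   and a word of distinct letters acts by annihilating first and creating
   afterwards, which leaves d+1 possibilities ([haagerup]).  On a finite set this
   fails, already for the constant vector.  But involutions of a finite set can
   have no short relation ([exists_locally_free]), and then the moments
   |(T_z^* T_z)^q e_a| are the same as on the tree ([moment_le]).  So, for large q,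
   the vectors on which some T_z exceeds (9/8)(d+1) have small trace, and they are
   damped by the resolvent Q = (1 + B)^-1, where B is a multiple of the sum of
   the (T_z^* T_z)^(2q) over a finite net of z.

   The constants fit because 4(d+1) <= 3 * 4^(d-1) for d >= 2; for d = 1 the
   identity operator is enough ([hard_family1]). *)

Set Implicit Arguments.
Unset Strict Implicit.
Unset Printing Implicit Defensive.

Import Order.TTheory GRing.Theory Num.Theory.
Import Normc numFieldNormedType.Exports.

Local Open Scope ring_scope.
Local Open Scope complex_scope.

(** * Finite sums and multi-indices *)

Section Preliminaries.

(** The source of both Cauchy-Schwarz inequalities below: for finite sums and for
   the real inner product of column vectors. *)
Lemma discriminant_le (R : realFieldType) (a b c : R) :
  (forall s t, 0 <= s ^+ 2 * a + 2 * (s * t * b) + t ^+ 2 * c) ->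
  b ^+ 2 <= a * c.
Proof.
move=> pos.
have a0 : 0 <= a.
  by have := pos 1 0; rewrite (_ : _ + _ = a)//; ring.
have [a_0|a1] := eqVneq a 0.
  suff -> : b = 0 by rewrite a_0 mul0r expr0n.
  apply/eqP; apply: contraT => b0.
  have b2 : 0 < b ^+ 2 by rewrite exprn_even_gt0.
  have := pos (- (c + 1) / b) 1.
  rewrite a_0 (_ : _ + _ = - c - 2); last by field.
  have := pos 0 1; rewrite a_0; lra.
have {a1}a0 : 0 < a by rewrite lt_neqAle eq_sym a1.
have := pos (- b) a.
rewrite (_ : _ + _ = a * (a * c - b ^+ 2)); last by ring.
by rewrite pmulr_rge0// subr_ge0.
Qed.

Lemma sum_CauchySchwarz (R : realFieldType) (I : finType) (a b : I -> R) :
  (\sum_i a i * b i) ^+ 2 <= (\sum_i a i ^+ 2) * (\sum_i b i ^+ 2).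
Proof.
apply: discriminant_le => s t.
rewrite !mulr_sumr -!big_split/=; apply: sumr_ge0 => i _.
by rewrite (_ : _ + _ = (s * a i + t * b i) ^+ 2) ?sqr_ge0//; ring.
Qed.

Context (J : finType).

Definition fcons d (j : J) (i : {ffun 'I_d -> J}) : {ffun 'I_d.+1 -> J} :=
  [ffun k => oapp i j (unlift ord0 k)].

Lemma fcons0 d j (i : {ffun 'I_d -> J}) : fcons j i ord0 = j.
Proof. by rewrite ffunE unlift_none. Qed.

Lemma fconsS d j (i : {ffun 'I_d -> J}) k : fcons j i (lift ord0 k) = i k.
Proof. by rewrite ffunE liftK. Qed.

Lemma fcons_inj d (j j' : J) (i i' : {ffun 'I_d -> J}) :
  fcons j i = fcons j' i' -> j = j' /\ i = i'.
Proof.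
move=> e; split; first by rewrite -(fcons0 j i) e fcons0.
by apply/ffunP => k; rewrite -(fconsS j i) e fconsS.
Qed.

Lemma fcons_surj d (i : {ffun 'I_d.+1 -> J}) :
  i = fcons (i ord0) [ffun k : 'I_d => i (lift ord0 k)].
Proof.
by apply/ffunP => k; rewrite ffunE; case: unliftP => [k'|] ->//=; rewrite ffunE.
Qed.

Lemma big_fcons (V : Type) (idx : V) (op : Monoid.com_law idx) d
    (F : {ffun 'I_d.+1 -> J} -> V) :
  \big[op/idx]_i F i = \big[op/idx]_j \big[op/idx]_i F (fcons j i).
Proof.
rewrite pair_bigA/= (reindex (fun p : J * {ffun 'I_d -> J} => fcons p.1 p.2))//.
exists (fun i : {ffun 'I_d.+1 -> J} =>
  (i ord0, [ffun k : 'I_d => i (lift ord0 k)])) => [[j i] _|i _] /=.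
  by rewrite fcons0; congr (_, _); apply/ffunP => k; rewrite ffunE fconsS.
by rewrite -fcons_surj.
Qed.

Lemma big_ffun0 (V : Type) (idx : V) (op : Monoid.com_law idx)
    (F : {ffun 'I_0 -> J} -> V) i0 : \big[op/idx]_i F i = F i0.
Proof.
rewrite (bigD1 i0)//= big1 ?Monoid.mulm1// => i /eqP[].
by apply/ffunP => -[].
Qed.

(** [word] over an arbitrary ring, so that matrices can be used as well. *)
Definition mono (A : pzRingType) d (X : 'I_d -> J -> A) (i : {ffun 'I_d -> J}) :=
  \prod_(k < d) X k (i k).

Lemma mono_fcons (A : pzRingType) d (X : 'I_d.+1 -> J -> A) j i :
  mono X (fcons j i) = X ord0 j * mono (fun k => X (lift ord0 k)) i.
Proof.
rewrite /mono big_ord_recl fcons0; congr (_ * _).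
by apply: eq_bigr => k _; rewrite fconsS.
Qed.

Lemma mono0 (A : pzRingType) (X : 'I_0 -> J -> A) i : mono X i = 1.
Proof. by rewrite /mono big_ord0. Qed.

End Preliminaries.

(** * Operators on $\ell_2$ *)

Section Operators.
Context (R : realType).
Local Notation K := R[i].
Local Notation ell2 := (ell2 R).
Local Notation bop := (bop R).

Lemma sqsum_bounded (f : nat -> K) (c : R) :
  (forall n, sqsum f n <= c) -> f \in @square_summable R.
Proof.
move=> fc; apply/square_summableP; apply: nondecreasing_is_cvgn.
  exact: sqsum_nd.
by exists c => _ [n _ <-].
Qed.

Definition ell2_of (f : nat -> K) c (fc : forall n, sqsum f n <= c) : ell2 :=
  Ell2 (sqsum_bounded fc).

Lemma ell2DE (u v : ell2) n : (u + v) n = u n + v n. Proof. by []. Qed.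
Lemma ell2ZE a (u : ell2) n : (a *: u) n = a * u n. Proof. by []. Qed.
Lemma ell2_sumE (I : Type) (r : seq I) (P : pred I) (u : I -> ell2) n :
  (\sum_(i <- r | P i) u i) n = \sum_(i <- r | P i) u i n.
Proof. by elim/big_rec2: _ => // i y x _ <-. Qed.

Lemma sqsumE (f : nat -> K) n : sqsum f n = \sum_(0 <= k < n) normc (f k) ^+ 2.
Proof. by []. Qed.

Lemma sqsum_ge0 (f : nat -> K) n : 0 <= sqsum f n.
Proof. by rewrite sqsumE sumr_ge0// => k _; rewrite exprn_ge0 ?normc_ge0. Qed.

(** Inequalities between sums of squared norms can be checked on partial sums, all
   truncated at the same place. *)
Lemma sum_sqr_l2norm_le (I : finType) (u : I -> ell2) (c : R) :
  (forall n, \sum_i sqsum (u i) n <= c) -> \sum_i l2norm (u i) ^+ 2 <= c.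
Proof.
move=> uc; under eq_bigr do rewrite sqr_l2norm.
have cvs (r : seq I) : ((fun n => \sum_(i <- r) sqsum (u i) n) @ \oo -->
    \sum_(i <- r) limn (sqsum (u i)))%classic.
  elim: r => [|i r IH].
    by rewrite big_nil; under eq_fun do rewrite big_nil; exact: cvg_cst.
  rewrite big_cons; under eq_fun do rewrite big_cons.
  by apply: cvgD IH; exact: sqsum_cvg.
apply: (cvgr_to_le (cvs (index_enum I))).
by apply: nearW => n; exact: uc.
Qed.

Lemma l2norm_sum (I : Type) (r : seq I) (P : pred I) (u : I -> ell2) :
  l2norm (\sum_(i <- r | P i) u i) <= \sum_(i <- r | P i) l2norm (u i).
Proof.
elim/big_ind2: _ => [|v a w b va wb|//]; first by rewrite l2norm0.
by apply: le_trans (ler_l2normD _ _) _; exact: lerD.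
Qed.

Lemma bounded_linear_operator (T : ell2 -> ell2) (c : R) :
  linear T -> (forall u, l2norm (T u) <= c * l2norm u) ->
  T \in @bounded_operator R.
Proof.
move=> lT cT; apply/bounded_operatorP; split=> //.
pose L := GRing.isLinear.Build R[i] ell2 ell2 *:%R T lT.
pose T' : {linear ell2 -> ell2} := HB.pack T L.
apply: (linear_bounded_continuous T').1.
apply/linear_boundedP; exists c%:C; split; first by rewrite complex_real.
move=> r cr u; rewrite !ell2_normE.
have -> : r = (complex.Re r)%:C.
  by rewrite RRe_real// (ger_real (ltW cr)) complex_real.
rewrite -rmorphM lecR/=; apply: le_trans (cT u) _.
rewrite ler_wpM2r ?l2norm_ge0//.
by have := ltW cr; rewrite lecE => /andP[].
Qed.

Definition bop_of (T : ell2 -> ell2) (c : R) (lT : linear T)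
    (cT : forall u, l2norm (T u) <= c * l2norm u) : bop :=
  Bop (bounded_linear_operator lT cT).

Lemma bopZE a (S : bop) u : (a *: S) u = a *: S u. Proof. by []. Qed.
Lemma bop_sumE (I : Type) (r : seq I) (P : pred I) (S : I -> bop) u :
  (\sum_(i <- r | P i) S i) u = \sum_(i <- r | P i) S i u.
Proof. by elim/big_rec2: _ => // i y x _ <-. Qed.

Lemma opnorm_le_of (T : bop) c :
  0 <= c -> (forall u, l2norm (T u) <= c * l2norm u) -> opnorm T <= c.
Proof.
move=> c0 Tc; apply: opnorm_le => u u1; apply: le_trans (Tc u) _.
by rewrite ler_piMr.
Qed.

Lemma contraction_l2norm (T : bop) (u : ell2) :
  opnorm T <= 1 -> l2norm (T u) <= l2norm u.
Proof.
move=> T1; apply: le_trans (l2norm_opnorm T u) _.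
by rewrite ler_piMl ?l2norm_ge0.
Qed.

Lemma word_mono m d (x : 'I_d -> 'I_m -> bop) i : word x i = mono x i.
Proof. by []. Qed.

Lemma word_fcons m d (x : 'I_d.+1 -> 'I_m -> bop) j i u :
  word x (fcons j i) u = x ord0 j (word (fun k => x (lift ord0 k)) i u).
Proof. by rewrite word_mono mono_fcons. Qed.

Lemma word0 m (x : 'I_0 -> 'I_m -> bop) i u : word x i u = u.
Proof. by rewrite word_mono mono0. Qed.

Lemma sqsum_delta (a n : nat) :
  sqsum (fun k => ((k == a)%:R : K)) n = (a < n)%:R.
Proof.
rewrite sqsumE; have e k : normc ((k == a)%:R : K) ^+ 2 = (k == a)%:R :> R.
  by case: eqP; rewrite ?normc1 ?normc0 ?expr1n ?expr0n.
under eq_bigr do rewrite e.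
elim: n => [|n IH]; first by rewrite big_nil.
by rewrite big_nat_recr//= IH -natrD ltnS; case: ltngtP.
Qed.

Definition unit_vec (a : nat) : ell2 :=
  ell2_of (c := 1) (f := fun k => (k == a)%:R)
    (fun n => ltac:(rewrite sqsum_delta; case: ltnP; rewrite ?ler01//)).

Lemma unit_vecE a n : unit_vec a n = (n == a)%:R. Proof. by []. Qed.

Lemma l2norm_unit_vec a : l2norm (unit_vec a) = 1.
Proof.
apply/eqP; rewrite eq_le; apply/andP; split.
  apply: l2norm_le => // n.
  by rewrite sqsum_delta expr1n; case: ltnP; rewrite ?ler01.
by have := normc_le_l2norm (unit_vec a) a; rewrite unit_vecE eqxx normc1.
Qed.

(** * Isometries with orthogonal ranges *)

Section Shifts.
Context (m : nat) (m_gt0 : (0 < m)%N).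

(** The isometries [up j] send the basis vector e_n to e_(n m + j); [down j] is the
   adjoint of [up j].  Cutting the integers into blocks of length m gives their
   relations. *)
Lemma sqsum_blocks (f : nat -> K) n :
  sqsum f (n * m) = \sum_(j < m) sqsum (fun k => f (k * m + j)%N) n.
Proof.
rewrite sqsumE big_nat_mul; under [RHS]eq_bigr do rewrite sqsumE.
rewrite exchange_big/=; apply: eq_bigr => k _.
rewrite mulSn -{1}[(k * m)%N]add0n big_addn addnK big_mkord.
by apply: eq_bigr => j _; rewrite addnC.
Qed.

Lemma sqsum_shift_le (u : ell2) (j : 'I_m) n :
  sqsum (fun k => u (k * m + j)%N) n <= l2norm u ^+ 2.
Proof.
apply: le_trans (sqsum_le u (n * m)); rewrite sqsum_blocks (bigD1 j)//= lerDl.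
by apply: sumr_ge0 => j' _; exact: sqsum_ge0.
Qed.

Definition down_fun (j : 'I_m) (u : ell2) : ell2 :=
  ell2_of (sqsum_shift_le u j).

Lemma down_linear j : linear (down_fun j).
Proof. by move=> a u v; exact: ell2P. Qed.

Lemma down_le j u : l2norm (down_fun j u) <= 1 * l2norm u.
Proof. by rewrite mul1r; apply: l2norm_le (l2norm_ge0 _) _; exact: sqsum_shift_le. Qed.

Definition down j : bop := bop_of (down_linear j) (down_le j).

Definition spread (j : 'I_m) (u : nat -> K) (n : nat) : K :=
  if (n %% m)%N == j then u (n %/ m)%N else 0.

Lemma spread_block (j j' : 'I_m) u k :
  spread j u (k * m + j') = if j' == j then u k else 0.
Proof.
by rewrite /spread modnMDl divnMDl// modn_small ?divn_small// addn0.
Qed.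

Lemma sqsum_spread_le (u : ell2) j n : sqsum (spread j u) n <= l2norm u ^+ 2.
Proof.
apply: le_trans (sqsum_le u n).
apply: le_trans (sqsum_nd (spread j u) (leq_pmulr n m_gt0)) _.
rewrite sqsum_blocks (bigD1 j)//= big1 ?addr0 => [|j' jj'].
  by rewrite le_eqVlt; apply/orP; left; apply/eqP/eq_bigr => k _; rewrite spread_block eqxx.
apply: big1 => k _.
by rewrite spread_block (negPf jj') normc0 expr0n.
Qed.

Definition up_fun (j : 'I_m) (u : ell2) : ell2 := ell2_of (sqsum_spread_le u j).

Lemma up_linear j : linear (up_fun j).
Proof.
move=> a u v; apply: ell2P => n; rewrite ell2DE ell2ZE /= /spread.
by case: ifP => _; rewrite ?mulr0 ?addr0// ell2DE ell2ZE.
Qed.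

Lemma up_le j u : l2norm (up_fun j u) <= 1 * l2norm u.
Proof. by rewrite mul1r; apply: l2norm_le (l2norm_ge0 _) _; exact: sqsum_spread_le. Qed.

Definition up j : bop := bop_of (up_linear j) (up_le j).

Lemma down_up j j' u : down j (up j' u) = if j == j' then u else 0.
Proof.
by apply: ell2P => n; rewrite [LHS]spread_block; case: (j == j').
Qed.

Lemma opnorm_up j : opnorm (up j) <= 1.
Proof. by apply: opnorm_le_of => // u; exact: up_le. Qed.

Lemma sum_down_le u : \sum_j l2norm (down j u) ^+ 2 <= l2norm u ^+ 2.
Proof.
apply: sum_sqr_l2norm_le => n.
by rewrite -(sqsum_blocks u); exact: sqsum_le.
Qed.

(** The adjoint of [word (fun=> up) i], hence the reversed order. *)
Fixpoint downs d : {ffun 'I_d -> 'I_m} -> bop :=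
  if d is d'.+1 then
    fun i => downs [ffun k : 'I_d' => i (lift ord0 k)] * down (i ord0)
  else fun=> 1.

Lemma downs_fcons d j (i : {ffun 'I_d -> 'I_m}) :
  downs (fcons j i) = downs i * down j.
Proof.
rewrite /= fcons0; congr (downs _ * _).
by apply/ffunP => k; rewrite ffunE fconsS.
Qed.

Lemma downs_up d (i i' : {ffun 'I_d -> 'I_m}) u :
  downs i (word (fun=> up) i' u) = if i == i' then u else 0.
Proof.
elim: d i i' u => [|d IH] i i' u.
  by rewrite word0/= (_ : i == i')//; apply/eqP/ffunP => -[].
rewrite (fcons_surj i) (fcons_surj i').
move: (i ord0) (i' ord0) [ffun k => _] [ffun k => _] => j j' {}i {}i'.
rewrite downs_fcons bop_mulE word_fcons down_up.
case: eqP => [->|jj'].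
  rewrite IH; case: eqP => [->|ii']; first by rewrite eqxx.
  by case: eqP => // /fcons_inj[].
by rewrite linear0; case: eqP => // /fcons_inj[].
Qed.

Lemma sum_downs_le d u :
  \sum_(i : {ffun 'I_d -> 'I_m}) l2norm (downs i u) ^+ 2 <= l2norm u ^+ 2.
Proof.
elim: d u => [|d IH] u; first by rewrite (big_ffun0 _ _ [ffun=> Ordinal m_gt0]).
rewrite big_fcons; apply: le_trans (sum_down_le u).
apply: ler_sum => j _; under eq_bigr do rewrite downs_fcons bop_mulE.
exact: IH.
Qed.

End Shifts.
End Operators.

(** * The two upper estimates *)

Section UpperEstimates.
Context (R : realType) (m : nat) (m_gt0 : (0 < m)%N).
Local Notation K := R[i].
Local Notation ell2 := (ell2 R).
Local Notation bop := (bop R).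

(** All the coordinates after the first one are encoded by isometries, whose ranges
   for distinct words are orthogonal; the first factor decodes the word and
   applies the corresponding member of the family. *)
Lemma factorizes_contractions d (x : {ffun 'I_d.+1 -> 'I_m} -> bop) (A : R) :
  0 < A -> A ^+ 2 = m%:R ^+ d -> (forall i, opnorm (x i) <= 1) ->
  factorizes A x.
Proof.
move=> A0 Am x1.
pose a j : bop := (A^-1)%:C *: \sum_w x (fcons j w) * downs R w.
exists (fun k j => if unlift ord0 k is Some _ then up R m_gt0 j else a j).
split=> [k j|i].
  case: unlift => [_|]; first exact: opnorm_up.
  apply: opnorm_le_of => // u; rewrite mul1r bopZE bop_sumE l2normZ.
  have -> : normc (A^-1)%:C = A^-1.
    by rewrite /= expr0n/= addr0 sqrtr_sqr ger0_norm// invr_ge0 ltW.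
  rewrite ler_pdivrMl//.
  apply: (@le_trans _ _ (\sum_(w : {ffun 'I_d -> 'I_m}) 1 * l2norm (downs R w u))).
    apply: le_trans (l2norm_sum _ _ _) _; apply: ler_sum => w _.
    by rewrite mul1r bop_mulE; exact: contraction_l2norm.
  rewrite -(@ler_pXn2r _ 2) ?nnegrE ?mulr_ge0 ?l2norm_ge0 ?(ltW A0)//; last first.
    by apply: sumr_ge0 => w _; rewrite mulr_ge0 ?l2norm_ge0.
  apply: le_trans (sum_CauchySchwarz _ _) _.
  rewrite exprMn Am ler_pM ?sumr_ge0//.
  - by move=> w _; rewrite sqr_ge0.
  - under eq_bigr do rewrite expr1n.
    by rewrite sumr_const card_ffun !card_ord -natrX.
  - exact: sum_downs_le.
apply: bopP => u; rewrite bopZE (fcons_surj i).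
move: (i ord0) [ffun k => _] => j w.
rewrite word_fcons unlift_none.
rewrite (_ : (fun k : 'I_d => _) = fun=> up R m_gt0); last first.
  by apply/funext => k; apply/funext => l; rewrite liftK.
rewrite bopZE bop_sumE (bigD1 w)//= [X in _ + X]big1 => [|w' ww'].
  rewrite addr0 ?bop_mulE downs_up eqxx scalerA -rmorphM/= divff ?scale1r//.
  by rewrite gt_eqF.
by rewrite ?bop_mulE downs_up (negPf ww') linear0.
Qed.

(** Domination tested on a coefficient family with a single nonzero entry. *)
Lemma triple_norm_dominated_contraction d (x : {ffun 'I_d -> 'I_m} -> bop) i :
  triple_norm_dominated x -> opnorm (x i) <= 1.
Proof.
move=> /(_ (fun i' => (i' == i)%:R)).
have sE (z : {ffun 'I_d -> 'I_m} -> bop) :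
    \sum_i' (i' == i)%:R *: z i' = z i.
  rewrite (bigD1 i)//= eqxx scale1r big1 ?addr0// => i' /negPf->.
  by rewrite scale0r.
rewrite sE => /le_trans; apply; apply: ge_sup.
  by case: (triple_norm_has_sup (fun i' => (i' == i)%:R : K)).
by move=> _ [y y1 <-]; rewrite sE; exact: opnorm_word_le1.
Qed.

(** The words in isometries with orthogonal ranges map a unit vector to an
   orthonormal family, so the supremum is already large at these isometries. *)
Lemma l2_le_triple_norm d (lambda : {ffun 'I_d -> 'I_m} -> K) :
  Num.sqrt (\sum_i normc (lambda i) ^+ 2) <= triple_norm lambda.
Proof.
pose S : bop := \sum_i lambda i *: word (fun=> up R m_gt0) i.
apply: (@le_trans _ _ (opnorm S)); last first.
  apply: sup_upper_bound (triple_norm_has_sup _) _ _.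
  by exists (fun=> up R m_gt0) => // k j; exact: opnorm_up.
pose f := S (unit_vec R 0).
apply: (@le_trans _ _ (l2norm f)); last by rewrite opnorm_ub ?l2norm_unit_vec.
rewrite -[l2norm f]ger0_norm ?l2norm_ge0// -sqrtr_sqr ler_wsqrtr//.
apply: le_trans (sum_downs_le m_gt0 d f).
apply: ler_sum => i _; rewrite /f /S bop_sumE linear_sum/=.
rewrite (bigD1 i)//= big1 => [|i' ii']; last first.
  by rewrite ?bopZE linearZ/= downs_up eq_sym (negPf ii') scaler0.
by rewrite addr0 ?bopZE linearZ/= downs_up eqxx l2normZ l2norm_unit_vec mulr1.
Qed.

Lemma l2_dominated_triple d (x : {ffun 'I_d -> 'I_m} -> bop) :
  l2_dominated x -> triple_norm_dominated x.
Proof. by move=> xl lambda; exact: le_trans (xl lambda) (l2_le_triple_norm _). Qed.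

End UpperEstimates.

(** * Fourier phases *)

Section Fourier.
Context (R : realType).
Local Notation K := R[i].
Local Notation ell2 := (ell2 R).
Local Notation bop := (bop R).

Lemma sqr_normc_conj (z : K) : (normc z ^+ 2)%:C = z * z^*%C.
Proof. by rewrite -sqr_normc normC_normc rmorphXn. Qed.

Lemma exists_prim_root m : (0 < m)%N -> exists w : K, m.-primitive_root w.
Proof.
move=> m_gt0; pose p : {poly K} := 'X^m - 1.
have [r Dp] := closed_field_poly_normal p.
move: Dp; rewrite (monicP _) ?monicXnsubC// scale1r => Dp.
have rm : all m.-unity_root r by apply/allP => z; rewrite -root_prod_XsubC -Dp.
have sz : (m < (size r).+1)%N by rewrite -(size_prod_XsubC r id) -Dp size_XnsubC.
have [|w _ wm] := hasP (cyclic.has_prim_root m_gt0 rm _ sz); last by exists w.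
by rewrite -separable_prod_XsubC -Dp separable_Xn_sub_1// pnatr_eq0 -lt0n.
Qed.

Context (m : nat) (w : K) (w_prim : m.-primitive_root w).

Lemma normc_prim_root : normc w = 1.
Proof.
apply/eqP; rewrite -(@pexpr_eq1 _ _ m) ?normc_ge0 ?(prim_order_gt0 w_prim)//.
have nX n : normc (w ^+ n) = normc w ^+ n.
  by elim: n => [|n IH]; rewrite ?normc1// !exprS normcM IH.
by rewrite -nX prim_expr_order// normc1.
Qed.

Lemma prim_root_conj : w * w^* = 1.
Proof. by rewrite -sqr_normc_conj normc_prim_root expr1n. Qed.

Lemma prim_rootX_conj n : w ^+ n * (w ^+ n)^* = 1.
Proof. by rewrite rmorphXn -exprMn prim_root_conj expr1n. Qed.

Lemma parseval (z : 'I_m -> K) :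
  \sum_(j < m) normc (\sum_(k < m) w ^+ (j * k) * z k) ^+ 2 =
  m%:R * \sum_k normc (z k) ^+ 2.
Proof.
apply: (fmorph_inj (real_complex R)); rewrite rmorphM rmorph_nat !rmorph_sum/=.
under eq_bigr do rewrite sqr_normc_conj rmorph_sum/= mulr_suml.
under [in RHS]eq_bigr do rewrite sqr_normc_conj.
rewrite exchange_big mulr_sumr; apply: eq_bigr => k _.
under eq_bigr do rewrite mulr_sumr.
rewrite exchange_big (bigD1 k)//= [X in _ + X]big1 ?addr0 => [|l lk].
  under eq_bigr => j _.
    rewrite rmorphM/= mulrACA prim_rootX_conj mul1r. over.
  by rewrite sumr_const card_ord mulr_natl.
pose y := w ^+ k * w^* ^+ l.
under eq_bigr => j _.
  rewrite rmorphM rmorphXn/= mulrACA ![(j * _)%N]mulnC !exprM -exprMn -/y. over.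
rewrite -mulr_suml.
have ym : y ^+ m = 1.
  rewrite exprMn exprAC (prim_expr_order w_prim) expr1n mul1r exprAC.
  by rewrite -rmorphXn/= (prim_expr_order w_prim) rmorph1 expr1n.
have y1 : y - 1 != 0.
  rewrite subr_eq0; apply: contra lk => /eqP yE.
  have : w ^+ k = w ^+ l.
    by rewrite -[RHS]mul1r -yE /y -mulrA -rmorphXn [_^* * _]mulrC prim_rootX_conj mulr1.
  move=> /eqP; rewrite (eq_prim_root_expr w_prim) !modn_small//.
  by move=> /eqP/val_inj->.
suff -> : \sum_(j < m) y ^+ j = 0 by rewrite mul0r.
by apply: (mulfI y1); rewrite mulr0 -subrX1 ym subrr.
Qed.

Lemma parseval_l2norm (u : 'I_m -> ell2) :
  \sum_(j < m) l2norm (\sum_(k < m) w ^+ (j * k) *: u k) ^+ 2 <=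
  m%:R * \sum_k l2norm (u k) ^+ 2.
Proof.
apply: sum_sqr_l2norm_le => n.
apply: (@le_trans _ _ (m%:R * \sum_k sqsum (u k) n)); last first.
  by rewrite ler_wpM2l// ler_sum// => k _; exact: sqsum_le.
rewrite le_eqVlt; apply/orP; left; apply/eqP.
under eq_bigr do rewrite sqsumE; under [in RHS]eq_bigr do rewrite sqsumE.
rewrite exchange_big [in RHS]exchange_big mulr_sumr; apply: eq_bigr => l _.
by rewrite -parseval; apply: eq_bigr => j _; rewrite ell2_sumE.
Qed.

(** The product of the w^(i_k i_(k+1)) over consecutive entries of the sequence that
   starts with [j] and continues with [i]. *)
Fixpoint phase d (j : 'I_m) : {ffun 'I_d -> 'I_m} -> K :=
  if d is d'.+1 then
    fun i => w ^+ (j * i ord0) * phase (i ord0) [ffun k : 'I_d' => i (lift ord0 k)]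
  else fun=> 1.

Lemma phase_fcons d j j' (i : {ffun 'I_d -> 'I_m}) :
  phase j (fcons j' i) = w ^+ (j * j') * phase j' i.
Proof.
rewrite /= fcons0; congr (_ * phase _ _).
by apply/ffunP => k; rewrite ffunE fconsS.
Qed.

Lemma phase_conj d j (i : {ffun 'I_d -> 'I_m}) : phase j i * (phase j i)^* = 1.
Proof.
elim: d j i => [|d IH] j i; first by rewrite /= rmorph1 mulr1.
by rewrite (fcons_surj i) phase_fcons rmorphM/= mulrACA prim_rootX_conj mul1r.
Qed.

Arguments phase : simpl never.

Context (N : nat).

(** The point reached from [a] by applying s_(0, i_0) first, then s_(1, i_1), and so
   on: the order in which a product of permutation matrices moves the index of
   a coordinate. *)
Fixpoint trans d (s : 'I_d -> 'I_m -> 'I_N -> 'I_N) :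
    {ffun 'I_d -> 'I_m} -> 'I_N -> 'I_N :=
  match d return ('I_d -> 'I_m -> 'I_N -> 'I_N) -> {ffun 'I_d -> 'I_m} -> 'I_N -> 'I_N with
  | d'.+1 => fun s i a =>
    trans (fun k => s (lift ord0 k)) [ffun k : 'I_d' => i (lift ord0 k)] (s ord0 (i ord0) a)
  | 0 => fun _ _ a => a
  end s.

Lemma trans_fcons d (s : 'I_d.+1 -> 'I_m -> 'I_N -> 'I_N) j i a :
  trans s (fcons j i) a = trans (fun k => s (lift ord0 k)) i (s ord0 j a).
Proof.
rewrite /= fcons0; congr trans.
by apply/ffunP => k; rewrite ffunE fconsS.
Qed.

Arguments trans : simpl never.

(** One more letter costs a factor m: a contraction on families of vectors, which is
   free, and a Fourier transform in the letter, which multiplies the sum of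
   squares by m. *)
Lemma phase_chain d (y : 'I_d.+1 -> 'I_m -> bop) (s : 'I_d.+1 -> 'I_m -> 'I_N -> 'I_N) :
  unit_family y -> (forall k j, injective (s k j)) ->
  \sum_j \sum_(a < N) l2norm (\sum_(i : {ffun 'I_d -> 'I_m})
      phase j i *: word y (fcons j i) (unit_vec R (trans s (fcons j i) a))) ^+ 2
    <= m%:R ^+ d.+1 * N%:R.
Proof.
elim: d y s => [|d IH] y s y1 s1.
  apply: (@le_trans _ _ (\sum_(j < m) \sum_(a < N) 1)); last first.
    by rewrite !sumr_const !card_ord expr1 -mulr_natl mulr1 -[N%:R *+ m]mulr_natl.
  apply: ler_sum => j _; apply: ler_sum => a _.
  rewrite (big_ffun0 _ _ [ffun=> j]) scale1r word_fcons word0.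
  rewrite expr_le1 ?l2norm_ge0//.
  by apply: le_trans (contraction_l2norm _ (y1 _ _)) _; rewrite l2norm_unit_vec.
pose y' k := y (lift ord0 k); pose s' k := s (lift ord0 k).
pose G j a := \sum_(i : {ffun 'I_d -> 'I_m})
  phase j i *: word y' (fcons j i) (unit_vec R (trans s' (fcons j i) a)).
have {}IH : \sum_j \sum_a l2norm (G j a) ^+ 2 <= m%:R ^+ d.+1 * N%:R.
  by apply: IH => // k j; [exact: y1 | exact: s1].
apply: (@le_trans _ _ (\sum_(j < m) \sum_(a < N)
    l2norm (\sum_(k < m) w ^+ (j * k) *: G k a) ^+ 2)).
  apply: ler_sum => j _; rewrite [leRHS](reindex_inj (s1 ord0 j)).
  apply: ler_sum => a _; rewrite lerXn2r ?nnegrE ?l2norm_ge0//.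
  apply: le_trans (contraction_l2norm _ (y1 ord0 j)).
  rewrite le_eqVlt; apply/orP; left; apply/eqP; congr l2norm.
  rewrite linear_sum/= big_fcons; apply: eq_bigr => k _.
  rewrite linearZ/= linear_sum/= scaler_sumr; apply: eq_bigr => i _.
  by rewrite phase_fcons linearZ/= scalerA word_fcons trans_fcons.
rewrite exchange_big/=.
apply: (@le_trans _ _ (\sum_(a < N) m%:R * \sum_j l2norm (G j a) ^+ 2)).
  by apply: ler_sum => a _; exact: parseval_l2norm.
rewrite -mulr_sumr [in leLHS]exchange_big exprS -mulrA ler_wpM2l//.
Qed.

(** Take the a-th coordinate of the vector at a and sum over a: this is the trace of
   the words twisted by the permutations. *)
Lemma phase_sum_le d (y : 'I_d.+1 -> 'I_m -> bop) (s : 'I_d.+1 -> 'I_m -> 'I_N -> 'I_N) :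
  unit_family y -> (forall k j, injective (s k j)) ->
  normc (\sum_j \sum_(a < N) \sum_(i : {ffun 'I_d -> 'I_m})
      phase j i * word y (fcons j i) (unit_vec R (trans s (fcons j i) a)) a) ^+ 2
    <= N%:R ^+ 2 * m%:R ^+ d.+2.
Proof.
move=> y1 s1; have := phase_chain y1 s1.
set G := (X in \sum_j \sum_a l2norm (X j a) ^+ 2) => GN.
have nsum (I : finType) (z : I -> K) : normc (\sum_i z i) <= \sum_i normc (z i).
  elim/big_ind2: _ => [|a p b q ap bq|//]; first by rewrite normc0.
  by apply: le_trans (normc_triangle _ _) _; exact: lerD.
apply: (@le_trans _ _ ((\sum_j \sum_a l2norm (G j a)) ^+ 2)).
  rewrite lerXn2r ?nnegrE ?normc_ge0//.
    by apply: sumr_ge0 => j _; apply: sumr_ge0 => a _; exact: l2norm_ge0.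
  apply: le_trans (nsum _ _) _; apply: ler_sum => j _.
  apply: le_trans (nsum _ _) _; apply: ler_sum => a _.
  apply: le_trans (normc_le_l2norm (G j a) a).
  by rewrite ell2_sumE le_eqVlt eqxx.
rewrite pair_bigA/= in GN; rewrite pair_bigA/=.
have := sum_CauchySchwarz (fun=> 1) (fun p : 'I_m * 'I_N => l2norm (G p.1 p.2)).
rewrite [in X in X <= _](eq_bigr (fun p => l2norm (G p.1 p.2))); last first.
  by move=> p _; rewrite mul1r.
move=> /le_trans; apply.
rewrite [in X in X * _](eq_bigr (fun=> 1)); last by move=> p _; rewrite expr1n.
rewrite sumr_const card_prod !card_ord natrM.
rewrite [leRHS](_ : _ = m%:R * N%:R * (m%:R ^+ d.+1 * N%:R)).
  by rewrite ler_wpM2l// mulr_ge0.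
by rewrite [m%:R ^+ d.+2]exprS; ring.
Qed.

End Fourier.

(** * Column vectors and matrices *)

Section Matrices.
Context (R : realType).
Local Notation K := R[i].

Lemma sqr_normc_ReIm (z : K) :
  normc z ^+ 2 = complex.Re z ^+ 2 + complex.Im z ^+ 2.
Proof. by case: z => x y; rewrite /= sqr_sqrtr ?addr_ge0 ?sqr_ge0. Qed.

Lemma normc_real (x : R) : 0 <= x -> normc x%:C = x.
Proof. by move=> x0; rewrite /= expr0n/= addr0 sqrtr_sqr ger0_norm. Qed.

Definition lnorm (I : finType) (z : I -> K) : R :=
  Num.sqrt (\sum_i normc (z i) ^+ 2).

Lemma lnorm_ge0 (I : finType) (z : I -> K) : 0 <= lnorm z.
Proof. exact: sqrtr_ge0. Qed.

Lemma sqr_lnorm (I : finType) (z : I -> K) :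
  lnorm z ^+ 2 = \sum_i normc (z i) ^+ 2.
Proof. by rewrite sqr_sqrtr// sumr_ge0// => i _; rewrite sqr_ge0. Qed.

Context (N : nat).
Implicit Types (u v : 'cV[K]_N) (M P : 'M[K]_N).

Definition nrm v : R := lnorm (fun a : 'I_N => v a 0).

(** The real part of the inner product: a real symmetric bilinear form with the
   same norm, for which matrices still have their Hermitian adjoints. *)
Definition dotr u v : R := complex.Re (\sum_a u a 0 * (v a 0)^*%C).

Definition hadj M : 'M[K]_N := \matrix_(a, b) (M b a)^*%C.

Lemma nrm_ge0 v : 0 <= nrm v. Proof. exact: lnorm_ge0. Qed.

Lemma sqr_nrm v : nrm v ^+ 2 = \sum_a normc (v a 0) ^+ 2.
Proof. exact: sqr_lnorm. Qed.

Lemma dotrr v : dotr v v = nrm v ^+ 2.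
Proof.
rewrite sqr_nrm /dotr; under eq_bigr do rewrite -sqr_normc_conj.
by rewrite -rmorph_sum.
Qed.

Lemma dotrDl u1 u2 v : dotr (u1 + u2) v = dotr u1 v + dotr u2 v.
Proof.
rewrite /dotr -raddfD -big_split/=; congr complex.Re.
by apply: eq_bigr => a _; rewrite mxE mulrDl.
Qed.

Lemma dotrC u v : dotr u v = dotr v u.
Proof.
have ReJ (z : K) : complex.Re z^*%C = complex.Re z by case: z.
rewrite /dotr -ReJ rmorph_sum; congr complex.Re; apply: eq_bigr => a _.
by rewrite rmorphM/= conjcK mulrC.
Qed.

Lemma dotrDr u v1 v2 : dotr u (v1 + v2) = dotr u v1 + dotr u v2.
Proof. by rewrite dotrC dotrDl ![dotr _ u]dotrC. Qed.

Lemma dotrZl (s : R) u v : dotr (s%:C *: u) v = s * dotr u v.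
Proof.
have ReM (z : K) : complex.Re (s%:C * z) = s * complex.Re z.
  by case: z => x y /=; rewrite mul0r subr0.
rewrite /dotr -ReM mulr_sumr; congr complex.Re.
by apply: eq_bigr => a _; rewrite mxE mulrA.
Qed.

Lemma dotrZr (s : R) u v : dotr u (s%:C *: v) = s * dotr u v.
Proof. by rewrite dotrC dotrZl dotrC. Qed.

Lemma dotr0l v : dotr 0 v = 0.
Proof. by have := dotrZl 0 0 v; rewrite scale0r mul0r. Qed.

Lemma dotrNl u v : dotr (- u) v = - dotr u v.
Proof. by apply/eqP; rewrite -addr_eq0 -dotrDl addNr dotr0l. Qed.

Lemma dotrNr u v : dotr u (- v) = - dotr u v.
Proof. by rewrite dotrC dotrNl dotrC. Qed.

Lemma dotr_suml (I : Type) (r : seq I) (F : I -> 'cV[K]_N) v (p : pred I) :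
  dotr (\sum_(i <- r | p i) F i) v = \sum_(i <- r | p i) dotr (F i) v.
Proof.
elim/big_rec2: _ => [|i y x _ <-]; [exact: dotr0l | exact: dotrDl].
Qed.

Lemma sqr_nrmD u v : nrm (u + v) ^+ 2 = nrm u ^+ 2 + 2 * dotr u v + nrm v ^+ 2.
Proof. by rewrite -!dotrr dotrDl !dotrDr [dotr v u]dotrC; ring. Qed.

Lemma dotr_le u v : dotr u v <= nrm u * nrm v.
Proof.
have h : dotr u v ^+ 2 <= nrm u ^+ 2 * nrm v ^+ 2.
  apply: discriminant_le => s t.
  rewrite (_ : _ + _ = nrm (s%:C *: u + t%:C *: v) ^+ 2) ?sqr_ge0//.
  by rewrite sqr_nrmD -!dotrr !dotrZl !dotrZr; ring.
have [d0|d0] := leP 0 (dotr u v).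
  by rewrite -(@ler_pXn2r _ 2) ?nnegrE ?mulr_ge0 ?nrm_ge0// exprMn.
by apply: le_trans (ltW d0) _; rewrite mulr_ge0 ?nrm_ge0.
Qed.

Lemma nrmD u v : nrm (u + v) <= nrm u + nrm v.
Proof.
rewrite -(@ler_pXn2r _ 2) ?nnegrE ?addr_ge0 ?nrm_ge0// sqr_nrmD.
by have := dotr_le u v; nra.
Qed.

Lemma nrmZ (c : K) v : nrm (c *: v) = normc c * nrm v.
Proof.
apply/eqP; rewrite -(@eqrXn2 _ 2) ?mulr_ge0 ?nrm_ge0 ?normc_ge0//; apply/eqP.
rewrite exprMn !sqr_nrm mulr_sumr; apply: eq_bigr => a _.
by rewrite mxE normcM exprMn.
Qed.

Lemma nrm0 : nrm 0 = 0.
Proof. by have := nrmZ 0 0; rewrite scale0r normc0 mul0r. Qed.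

Lemma nrm_sum (I : finType) (F : I -> 'cV[K]_N) : nrm (\sum_i F i) <= \sum_i nrm (F i).
Proof.
elim/big_ind2: _ => [|x a y b xa yb|//]; first by rewrite nrm0.
by apply: le_trans (nrmD _ _) _; exact: lerD.
Qed.

Lemma nrm_sum_scale_le (I : finType) (z : I -> K) (F : I -> 'cV[K]_N) (c : R) :
  0 <= c -> \sum_i nrm (F i) ^+ 2 <= c ^+ 2 ->
  nrm (\sum_i z i *: F i) <= lnorm z * c.
Proof.
move=> c0 Fc; apply: le_trans (nrm_sum _) _.
under eq_bigr do rewrite nrmZ.
rewrite -(@ler_pXn2r _ 2) ?nnegrE ?mulr_ge0 ?lnorm_ge0//; last first.
  by apply: sumr_ge0 => i _; rewrite mulr_ge0 ?nrm_ge0 ?normc_ge0.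
apply: le_trans (sum_CauchySchwarz _ _) _.
by rewrite exprMn sqr_lnorm ler_wpM2l// sumr_ge0// => i _; rewrite sqr_ge0.
Qed.

Lemma nrm_eq0 v : nrm v = 0 -> v = 0.
Proof.
move=> v0; have := sqr_nrm v; rewrite v0 expr0n/= => /esym/eqP.
rewrite psumr_eq0 => [/allP h|a _]; last by rewrite sqr_ge0.
apply/matrixP => a j; rewrite ord1 mxE; apply: eq0_normc.
by have /(_ (mem_index_enum a)) := h a; rewrite sqrf_eq0 => /eqP.
Qed.

Lemma hadjK M : hadj (hadj M) = M.
Proof. by apply/matrixP => a b; rewrite !mxE conjcK. Qed.

Lemma hadjD M P : hadj (M + P) = hadj M + hadj P.
Proof. by apply/matrixP => a b; rewrite !mxE rmorphD. Qed.

Lemma hadj0 : hadj 0 = 0.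
Proof. by apply/matrixP => a b; rewrite !mxE rmorph0. Qed.

Lemma hadjZ c M : hadj (c *: M) = c^*%C *: hadj M.
Proof. by apply/matrixP => a b; rewrite !mxE rmorphM. Qed.

Lemma hadjM M P : hadj (M * P) = hadj P * hadj M.
Proof.
apply/matrixP => a b; rewrite -!mulmxE !mxE rmorph_sum; apply: eq_bigr => c _.
by rewrite !mxE rmorphM mulrC.
Qed.

Lemma hadj1 : hadj 1 = 1.
Proof. by rewrite -[hadj 1]mulr1 -{2}(hadjK 1) -hadjM mulr1 hadjK. Qed.

Lemma hadj_sum (I : Type) (r : seq I) (p : pred I) (F : I -> 'M[K]_N) :
  hadj (\sum_(i <- r | p i) F i) = \sum_(i <- r | p i) hadj (F i).
Proof. by elim/big_rec2: _ => [|i y x _ <-]; [exact: hadj0|exact: hadjD]. Qed.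

Lemma dotr_hadj M u v : dotr (M *m u) v = dotr u (hadj M *m v).
Proof.
rewrite /dotr; congr complex.Re.
under eq_bigr do rewrite mxE mulr_suml.
rewrite exchange_big; apply: eq_bigr => b _.
rewrite mxE rmorph_sum mulr_sumr; apply: eq_bigr => a _.
by rewrite mxE rmorphM/= conjcK mulrA [M a b * _]mulrC.
Qed.

(** From |M^* v|^2 = <M M^* v, v>. *)
Lemma nrm_hadj_le M c : 0 <= c -> (forall v, nrm (M *m v) <= c * nrm v) ->
  forall v, nrm (hadj M *m v) <= c * nrm v.
Proof.
move=> c0 Mc v; set x := nrm (hadj M *m v).
have [->|x0] := eqVneq x 0; first by rewrite mulr_ge0 ?nrm_ge0.
have {}x0 : 0 < x by rewrite lt_neqAle eq_sym x0 nrm_ge0.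
rewrite -(ler_pM2l x0) -expr2 -dotrr -dotr_hadj.
apply: le_trans (dotr_le _ _) _; rewrite mulrCA mulrA ler_wpM2r ?nrm_ge0//.
Qed.

Lemma mulmx_mul M P v : (M * P) *m v = M *m (P *m v).
Proof. by rewrite -mulmxE mulmxA. Qed.

Lemma mx1_mul v : (1 : 'M[K]_N) *m v = v.
Proof. exact: mul1mx. Qed.

End Matrices.

(** * A Haagerup inequality *)

Section Haagerup.
Context (R : realType) (N : nat) (S : finType) (sg : S -> 'I_N -> 'I_N).
Local Notation K := R[i].
Context (sgK : forall s, involutive (sg s)).
Context (D : S -> pred 'I_N).
Context (D_disj : forall s t a, D s a -> D t a -> s = t).

(** [D s a] is to be thought of as: the reduced word at the point [a] starts with
   the letter [s]; the sets [D s] are disjoint because a word has at most one first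
   letter.  Then [creation s] adds the letter [s] and [annihilation s] removes it. *)
Definition creation s : 'M[K]_N := \matrix_(a, b) (D s a && (b == sg s a))%:R.
Definition annihilation s : 'M[K]_N :=
  \matrix_(a, b) (D s (sg s a) && (b == sg s a))%:R.
Definition field_op s := creation s + annihilation s.

Lemma pick_sum (v : 'cV[K]_N) (c : bool) (a : 'I_N) :
  \sum_b (c && (b == a))%:R * v b 0 = if c then v a 0 else 0.
Proof.
rewrite (bigD1 a)//= eqxx andbT big1 => [|b /negPf->].
  by case: c; rewrite ?mul1r ?mul0r addr0.
by rewrite andbF mul0r.
Qed.

Lemma creationE s (v : 'cV[K]_N) a j :
  (creation s *m v) a j = if D s a then v (sg s a) 0 else 0.
Proof. by rewrite ord1 mxE -pick_sum; apply: eq_bigr => b _; rewrite mxE. Qed.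

Lemma annihilationE s (v : 'cV[K]_N) a j :
  (annihilation s *m v) a j = if D s (sg s a) then v (sg s a) 0 else 0.
Proof. by rewrite ord1 mxE -pick_sum; apply: eq_bigr => b _; rewrite mxE. Qed.

Lemma mulmx_ext (M P : 'M[K]_N) : (forall v : 'cV_N, M *m v = P *m v) -> M = P.
Proof.
move=> MP; apply/matrixP => a b.
have : col b M = col b P by rewrite !colE MP.
by move=> /matrixP/(_ a 0); rewrite !mxE.
Qed.

Lemma annihilation_creation s t : s != t -> annihilation s * creation t = 0.
Proof.
move=> st; apply: mulmx_ext => v; apply/matrixP => a j.
rewrite mulmx_mul mul0mx annihilationE creationE mxE.
case: ifP => // Ds; case: ifP => // Dt.
by move: st; rewrite (D_disj Ds Dt) eqxx.
Qed.

Lemma hadj_creation s : hadj (creation s) = annihilation s.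
Proof.
apply/matrixP => a b; rewrite !mxE conjc_nat; congr (_%:R).
have [->|ba] := eqVneq b (sg s a); first by rewrite sgK eqxx !andbT.
rewrite !andbF; have [aE|_] := eqVneq a (sg s b); last by rewrite andbF.
by move: ba; rewrite aE sgK eqxx.
Qed.

Lemma hadj_field_op s : hadj (field_op s) = field_op s.
Proof. by rewrite /field_op hadjD -hadj_creation hadjK addrC. Qed.

(** Creation operators have orthogonal ranges. *)
Lemma sum_creation_le (m : nat) (l : 'I_m -> S) (f : 'I_m -> 'cV[K]_N) :
  injective l ->
  nrm (\sum_j creation (l j) *m f j) ^+ 2 <= \sum_j nrm (f j) ^+ 2.
Proof.
move=> linj; rewrite sqr_nrm.
under [leRHS]eq_bigr => j _.
  rewrite sqr_nrm (reindex_inj (inv_inj (sgK (l j)))). over.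
rewrite [leRHS]exchange_big; apply: ler_sum => a _.
have -> : (\sum_j creation (l j) *m f j) a 0 =
    \sum_j if D (l j) a then f j (sg (l j) a) 0 else 0.
  by rewrite summxE; apply: eq_bigr => j _; rewrite creationE.
have [/existsP[j Dj]|/existsPn nD] := boolP [exists j, D (l j) a].
  rewrite (bigD1 j)//= big1 => [|k kj].
    rewrite Dj addr0 (bigD1 j)//= lerDl.
    by apply: sumr_ge0 => k _; rewrite sqr_ge0.
  case: ifP => // Dk; move: kj.
  by rewrite (linj _ _ (D_disj Dk Dj)) eqxx.
rewrite big1 => [|j _]; last by rewrite (negPf (nD j)).
by rewrite normc0 expr0n; apply: sumr_ge0 => k _; rewrite sqr_ge0.
Qed.

(** Annihilation operators read disjoint parts of the vector. *)
Lemma sum_annihilation_le (m : nat) (l : 'I_m -> S) (v : 'cV[K]_N) :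
  injective l ->
  \sum_j nrm (annihilation (l j) *m v) ^+ 2 <= nrm v ^+ 2.
Proof.
move=> linj; under eq_bigr => j _.
  rewrite sqr_nrm (reindex_inj (inv_inj (sgK (l j)))).
  under eq_bigr => a _ do rewrite annihilationE sgK. over.
rewrite /= exchange_big sqr_nrm; apply: ler_sum => a _.
have [/existsP[j Dj]|/existsPn nD] := boolP [exists j, D (l j) a].
  rewrite (bigD1 j)//= big1 => [|k kj]; first by rewrite Dj addr0.
  case: ifP => [Dk|]; last by rewrite normc0 expr0n.
  by move: kj; rewrite (linj _ _ (D_disj Dk Dj)) eqxx.
rewrite big1 ?sqr_ge0// => j _; first by rewrite (negPf (nD j)) normc0 expr0n.
Qed.

Definition letters d m (l : 'I_d -> 'I_m -> S) :=
  forall k j k' j', l k j = l k' j' -> k = k' /\ j = j'.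

Lemma letters_tail d m (l : 'I_d.+1 -> 'I_m -> S) :
  letters l -> letters (fun k => l (lift ord0 k)).
Proof. by move=> ll k j k' j' /ll[/lift_inj-> ->]. Qed.

Lemma letters_inj d m (l : 'I_d -> 'I_m -> S) k : letters l -> injective (l k).
Proof. by move=> ll j j' /ll[]. Qed.

Lemma sum_annihilations_le d m (l : 'I_d -> 'I_m -> S) (v : 'cV[K]_N) :
  letters l ->
  \sum_i nrm (mono (fun k j => annihilation (l k j)) i *m v) ^+ 2 <= nrm v ^+ 2.
Proof.
elim: d l => [|d IH] l ll.
  case: m l ll => [|m] l ll.
    have i0 : {ffun 'I_0 -> 'I_0} by apply: finfun => -[].
    by rewrite (big_ffun0 _ _ i0) mono0 mx1_mul.
  by rewrite (big_ffun0 _ _ [ffun=> ord0]) mono0 mx1_mul.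
rewrite big_fcons exchange_big/=; apply: le_trans (IH _ (letters_tail ll)).
apply: ler_sum => i _; under eq_bigr do rewrite mono_fcons mulmx_mul.
exact/sum_annihilation_le/letters_inj.
Qed.

(** In a word of distinct letters, an annihilation at the left end forces all the
   letters on its right to annihilate as well: a letter that was just created can
   only be cancelled by itself. *)
Lemma annihilation_field_ops d m (l : 'I_d -> 'I_m -> S) s i :
  letters l -> (forall k j, s != l k j) ->
  annihilation s * mono (fun k j => field_op (l k j)) i =
  annihilation s * mono (fun k j => annihilation (l k j)) i.
Proof.
elim: d l s i => [|d IH] l s i ll sl; first by rewrite !mono0.
rewrite (fcons_surj i); move: (i ord0) [ffun k => _] => j {}i.
rewrite !mono_fcons mulrA mulrDr annihilation_creation// add0r -mulrA IH//.
  exact: letters_tail.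
by move=> k j'; apply/eqP => /ll[].
Qed.

(** By the previous lemma a product of field operators is a sum of d+1 terms: some
   creations followed (on the right) by annihilations only.  The induction peels off
   a creation, which preserves the bound by orthogonality, and the term with
   annihilations only contributes |z| by Cauchy-Schwarz. *)
Lemma haagerup d m (l : 'I_d -> 'I_m -> S) (z : {ffun 'I_d -> 'I_m} -> K) v :
  letters l ->
  nrm (\sum_i z i *: (mono (fun k j => field_op (l k j)) i *m v)) <=
  d.+1%:R * lnorm z * nrm v.
Proof.
elim: d l z => [|d IH] l z ll.
  rewrite mul1r; apply: nrm_sum_scale_le; rewrite ?nrm_ge0//.
  apply: le_trans (sum_annihilations_le v ll).
  by apply: ler_sum => i _; rewrite !mono0.
have ll' := letters_tail ll.
set F := fun k j => field_op (l k j).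
pose F' k := F (lift ord0 k).
pose A k j := annihilation (l k j).
have -> : \sum_i z i *: (mono F i *m v) =
    \sum_j creation (l ord0 j) *m (\sum_i z (fcons j i) *: (mono F' i *m v)) +
    \sum_i z i *: (mono A i *m v).
  rewrite [in LHS]big_fcons [X in _ = _ + X]big_fcons -big_split/=.
  apply: eq_bigr => j _; rewrite mulmx_sumr -big_split/=; apply: eq_bigr => i _.
  rewrite !mono_fcons -scalemxAr -scalerDr; congr (_ *: _).
  rewrite -[in RHS]mulmx_mul -mulmxDl; congr (_ *m _).
  rewrite {1}/F /field_op mulrDl; congr (_ + _).
  by apply: annihilation_field_ops => // k j'; apply/eqP => /ll[].
apply: le_trans (nrmD _ _) _.
rewrite -[d.+2]addn1 natrD mulrDl mulrDl mul1r; apply: lerD; last first.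
  by apply: nrm_sum_scale_le; rewrite ?nrm_ge0//; exact: sum_annihilations_le.
rewrite -(@ler_pXn2r _ 2) ?nnegrE ?mulr_ge0 ?nrm_ge0 ?lnorm_ge0//.
apply: le_trans (sum_creation_le _ (letters_inj (k := ord0) ll)) _.
rewrite !exprMn sqr_lnorm big_fcons mulr_sumr mulr_suml.
apply: ler_sum => j _; rewrite -sqr_lnorm -!exprMn.
by rewrite lerXn2r ?nnegrE ?nrm_ge0 ?mulr_ge0 ?nrm_ge0 ?lnorm_ge0//; exact: IH.
Qed.

End Haagerup.

(** * Involutions without short relations *)

(** Around each point, up to distance L, the involutions move as on the tree of
   reduced words: [D s] stands for the points whose word starts with [s], and
   crossing an edge labelled [s] near the centre adds or removes this letter. *)
Definition locally_free (S : finType) N (sg : S -> 'I_N -> 'I_N) (L : nat) : Prop :=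
  (forall s, involutive (sg s)) /\
  forall a, exists (D : S -> pred 'I_N) (ball : nat -> pred 'I_N),
    [/\ forall s t b, D s b -> D t b -> s = t,
        ball 0%N a &
        forall l s b, (l < L)%N -> ball l b ->
          ball l.+1 (sg s b) /\ D s b = ~~ D s (sg s b)].

Section FreeInvolutions.
Context (S : finType) (L : nat).

Definition starts s (w : seq S) := ohead w == Some s.

Definition reduced (w : seq S) := sorted (fun s t => s != t) w.

(** Multiplication by the letter [s], truncated at length [L] so as to remain an
   involution of the finite set of words of length at most [L].  The words
   starting with [s s] are also fixed, which makes this an involution on all
   words, reduced or not. *)
Definition step (s : S) (w : seq S) : seq S :=
  if w is t :: w' then
    if (t == s) then (if starts s w' then w else w')
    else if (size w < L)%N then s :: w else w
  else if (0 < L)%N then [:: s] else [::].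

Lemma size_step s w : (size w <= L)%N -> (size (step s w) <= L)%N.
Proof.
case: w => [|t w] /= wL; first by case: ifP.
by case: ifP => _; case: ifP => _ //=; exact: ltnW.
Qed.

Lemma stepK s w : (size w <= L)%N -> step s (step s w) = w.
Proof.
case: w => [|t w] /= wL.
  case: ifP => L0 /=; last by rewrite L0.
  by rewrite eqxx.
have [ts|ts] := eqVneq t s.
  subst t; have [sw|sw] := boolP (starts s w); first by rewrite /= eqxx sw.
  case: w sw wL => [|t w] /= tw wL; first by rewrite wL.
  by rewrite [t == s](negbTE tw) wL.
case: ifP => wL'; rewrite /= ?eqxx /starts/= ?[Some t == _](negPf ts)//.
by rewrite (negPf ts) wL'.
Qed.

Lemma step_reduced s w l : (l < L)%N -> (size w <= l)%N -> reduced w ->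
  [/\ (size (step s w) <= l.+1)%N, reduced (step s w) &
      starts s w = ~~ starts s (step s w)].
Proof.
case: w => [|t w] /= lL wl rw; first by rewrite (leq_ltn_trans _ lL)//= /starts/= eqxx.
have [ts|ts] := eqVneq t s.
  subst t; have sw : ~~ starts s w.
    by case: w rw {wl} => //= t w /andP[st _]; rewrite /starts/= eq_sym.
  rewrite (negPf sw); split; rewrite ?sw /starts/= ?eqxx//.
    by rewrite ltnW// ltnW.
  exact: path_sorted rw.
rewrite (leq_ltn_trans wl lL) /starts/= eqxx; split=> //.
  by rewrite eq_sym ts.
by apply/negbTE.
Qed.

Definition step_bseq s (w : L.-bseq S) : L.-bseq S :=
  Bseq (size_step s (size_bseq w)).

Lemma step_bseqK s : involutive (step_bseq s).
Proof. by move=> w; apply/val_inj/stepK/size_bseq. Qed.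

Definition step_perm s : {perm L.-bseq S} := perm (inv_inj (step_bseqK s)).

(** Seen from a permutation [g], the permutation [h] carries the word
   [h (g^-1 [::])]: this map is equivariant for composition with
   [step_perm s] and sends [g] itself to the empty word. *)
Lemma exists_locally_free : exists N (sg : S -> 'I_N -> 'I_N),
  (0 < N)%N /\ locally_free sg L.
Proof.
pose A := {perm L.-bseq S}.
pose sA s (h : A) : A := (h * step_perm s)%g.
have sAK s : involutive (sA s).
  move=> h; rewrite /sA -mulgA -[RHS]mulg1; congr (_ * _)%g.
  by apply/permP => w; rewrite permM !permE step_bseqK.
exists #|A|, (fun s a => enum_rank (sA s (enum_val a))); split.
  by apply/card_gt0P; exists 1%g.
split=> [s a|a]; first by rewrite enum_rankK sAK enum_valK.
pose wd (b : 'I_#|A|) : seq S := (enum_val b : A) ((enum_val a : A)^-1%g (nil_bseq L S)).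
exists (fun s b => starts s (wd b)),
       (fun l b => (size (wd b) <= l)%N && reduced (wd b)).
split=> [s t b|//|l s b lL /andP[bl br]].
- by rewrite /starts => /eqP-> /eqP[].
- by rewrite /wd permKV.
- have -> : wd (enum_rank (sA s (enum_val b))) = step s (wd b).
    by rewrite /wd enum_rankK permM permE.
  by have [-> ->] := step_reduced s lL bl br.
Qed.

End FreeInvolutions.

(** * Moments *)

Section Moments.
Context (R : realType) (N : nat).
Local Notation K := R[i].

Section Local.
Context (ball : nat -> pred 'I_N) (L : nat).

Definition supported l (v : 'cV[K]_N) := forall b, v b 0 != 0 -> ball l b.

Definition agree l (P P' : 'M[K]_N) := forall k (v : 'cV[K]_N),
  (k + l <= L)%N -> supported k v -> P *m v = P' *m v /\ supported (k + l) (P *m v).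

(** [P] and [P'] (and their adjoints) coincide on the vectors supported near the
   centre of the balls, and [l] bounds how far they propagate. *)
Definition local_agree l P P' := agree l P P' /\ agree l (hadj P) (hadj P').

Lemma supported_sum k (I : finType) (F : I -> 'cV[K]_N) :
  (forall i, supported k (F i)) -> supported k (\sum_i F i).
Proof.
move=> kF b; rewrite summxE; apply: contraNT => kb.
apply/eqP/big1 => i _; apply/eqP; apply: contraNT kb; exact: kF.
Qed.

Lemma supportedZ k c v : supported k v -> supported k (c *: v).
Proof. by move=> kv b; rewrite mxE mulf_eq0 negb_or => /andP[_]; exact: kv. Qed.

Lemma agreeM l1 l2 P P' Q Q' :
  agree l1 P P' -> agree l2 Q Q' -> agree (l2 + l1) (P * Q) (P' * Q').
Proof.
move=> PP QQ k v; rewrite addnA => kL kv.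
have [e1 s1] := QQ k v (leq_trans (leq_addr _ _) kL) kv.
have [e2 s2] := PP _ _ kL s1.
by rewrite !mulmx_mul -e1 -e2.
Qed.

Lemma agree_sum l (I : finType) (c : I -> K) (P P' : I -> 'M[K]_N) :
  (forall i, agree l (P i) (P' i)) ->
  agree l (\sum_i c i *: P i) (\sum_i c i *: P' i).
Proof.
move=> PP k v kL kv; rewrite !mulmx_suml; split.
  apply: eq_bigr => i _; rewrite -!scalemxAl.
  by have [->] := PP i k v kL kv.
apply: supported_sum => i; rewrite -scalemxAl; apply: supportedZ.
by have [] := PP i k v kL kv.
Qed.

Lemma local_agreeM l1 l2 P P' Q Q' :
  local_agree l1 P P' -> local_agree l2 Q Q' ->
  local_agree (l2 + l1) (P * Q) (P' * Q').
Proof.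
move=> [p p'] [q q']; split; first exact: agreeM.
by rewrite !hadjM addnC; exact: agreeM.
Qed.

Lemma local_agree_sum l (I : finType) (c : I -> K) (P P' : I -> 'M[K]_N) :
  (forall i, local_agree l (P i) (P' i)) ->
  local_agree l (\sum_i c i *: P i) (\sum_i c i *: P' i).
Proof.
move=> PP; split; first by apply: agree_sum => i; case: (PP i).
have e (Q : I -> 'M[K]_N) :
    hadj (\sum_i c i *: Q i) = \sum_i (c i)^*%C *: hadj (Q i).
  by rewrite hadj_sum; apply: eq_bigr => i _; rewrite hadjZ.
rewrite !e.
by apply: agree_sum => i; case: (PP i).
Qed.

Lemma local_agree1 : local_agree 0 1 1.
Proof. by split=> k v; rewrite ?hadj1 addn0 mx1_mul. Qed.

Lemma local_agree_adj l P P' : local_agree l P P' -> local_agree l (hadj P) (hadj P').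
Proof. by move=> [p p']; split; rewrite ?hadjK. Qed.

Lemma local_agreeX l P P' n : local_agree l P P' -> local_agree (n * l) (P ^+ n) (P' ^+ n).
Proof.
move=> PP; elim: n => [|n IH]; first exact: local_agree1.
by rewrite !exprSr mulSn; exact: local_agreeM.
Qed.

Lemma local_agree_mono d m (X X' : 'I_d -> 'I_m -> 'M[K]_N) i :
  (forall k j, local_agree 1 (X k j) (X' k j)) -> local_agree d (mono X i) (mono X' i).
Proof.
elim: d X X' i => [|d IH] X X' i XX; first by rewrite !mono0; exact: local_agree1.
rewrite (fcons_surj i) !mono_fcons; move: (i ord0) [ffun k => _] => j {}i.
have := local_agreeM (XX ord0 j) (IH _ _ i (fun k => XX (lift ord0 k))).
by rewrite addn1.
Qed.

End Local.

Definition shuffle (s : 'I_N -> 'I_N) : 'M[K]_N := \matrix_(a, b) (b == s a)%:R.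

Lemma shuffleE s (v : 'cV[K]_N) a j : (shuffle s *m v) a j = v (s a) 0.
Proof.
rewrite ord1 mxE (bigD1 (s a))//= mxE eqxx mul1r big1 ?addr0// => b /negPf ba.
by rewrite mxE ba mul0r.
Qed.

Lemma hadj_shuffle s : involutive s -> hadj (shuffle s) = shuffle s.
Proof.
move=> sK; apply/matrixP => a b; rewrite !mxE conjc_nat.
by rewrite -(inj_eq (inv_inj sK)) sK eq_sym.
Qed.

Context (S : finType) (sg : S -> 'I_N -> 'I_N) (L : nat).
Context (sg_free : locally_free sg L).

Lemma nrm_shuffle s (v : 'cV[K]_N) : nrm (shuffle (sg s) *m v) = nrm v.
Proof.
apply/eqP; rewrite -(@eqrXn2 _ 2) ?nrm_ge0//; apply/eqP; rewrite !sqr_nrm.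
rewrite [RHS](reindex_inj (inv_inj (sg_free.1 s))); apply: eq_bigr => a _.
by rewrite shuffleE.
Qed.

Definition letter_word d m (l : 'I_d -> 'I_m -> S) (i : {ffun 'I_d -> 'I_m}) :=
  mono (fun k j => shuffle (sg (l k j))) i.

Lemma nrm_letter_word d m (l : 'I_d -> 'I_m -> S) i (v : 'cV[K]_N) :
  nrm (letter_word l i *m v) = nrm v.
Proof.
elim: d l i v => [|d IH] l i v; first by rewrite /letter_word mono0 mx1_mul.
rewrite (fcons_surj i) /letter_word mono_fcons mulmx_mul nrm_shuffle.
exact: (IH (fun k => l (lift ord0 k))).
Qed.

Definition combination d m (l : 'I_d -> 'I_m -> S) (z : {ffun 'I_d -> 'I_m} -> K) :=
  \sum_i z i *: letter_word l i.

(** A vector supported at [a] does not see the difference between the permutation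
   matrices and the field operators as long as it has propagated less than [L],
   and the field operators satisfy Haagerup's inequality. *)
Lemma moment_le d m (l : 'I_d -> 'I_m -> S) (z : {ffun 'I_d -> 'I_m} -> K) q a :
  letters l -> (q * (d + d) <= L)%N -> lnorm z <= 1 ->
  nrm ((hadj (combination l z) * combination l z) ^+ q *m delta_mx a 0) <=
    d.+1%:R ^+ (2 * q).
Proof.
move=> ll qL z1; have [sgK /(_ a)[D [ball [D_disj ball0 grow]]]] := sg_free.
have fieldP s : agree ball L 1 (shuffle (sg s)) (field_op R sg D s).
  move=> k v kL kv; rewrite addn1 in kL *; split; last first.
    move=> b; rewrite shuffleE => /kv ks.
    by have [] := grow _ s _ kL ks; rewrite sgK.
  apply/matrixP => b j; rewrite shuffleE mulmxDl mxE creationE annihilationE.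
  have [->|/kv ks] := eqVneq (v (sg s b) 0) 0; first by rewrite !if_same addr0.
  have [_] := grow _ s _ kL ks; rewrite sgK => ->.
  by case: (D s b); rewrite /= ?addr0 ?add0r.
have lfieldP s : local_agree ball L 1 (shuffle (sg s)) (field_op R sg D s).
  by split; rewrite ?hadj_shuffle// ?hadj_field_op.
pose T := \sum_i z i *: mono (fun k j => field_op R sg D (l k j)) i.
have TP : local_agree ball L d (combination l z) T.
  by apply: local_agree_sum => i; apply: local_agree_mono => k j; exact: lfieldP.
have HP := local_agreeX q (local_agreeM (local_agree_adj TP) TP).
have supp0 : supported ball 0 (delta_mx a 0).
  by move=> b; rewrite mxE eqxx andbT; have [->|_] := eqVneq b a; rewrite ?eqxx.
have [-> _] := HP.1 0%N (delta_mx a 0) qL supp0.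
have c0 : 0 <= d.+1%:R :> R by [].
have Tle v : nrm (T *m v) <= d.+1%:R * nrm v.
  rewrite mulmx_suml; under eq_bigr do rewrite -scalemxAl.
  apply: le_trans (haagerup sgK D_disj z v ll) _.
  by rewrite ler_wpM2r ?nrm_ge0// ler_piMr.
(* All the powers of [hadj T * T] inherit the square of the bound for [T]. *)
have Hle v : nrm ((hadj T * T) *m v) <= d.+1%:R ^+ 2 * nrm v.
  rewrite mulmx_mul expr2 -mulrA; apply: le_trans (nrm_hadj_le c0 Tle _) _.
  by rewrite ler_wpM2l.
rewrite exprM; elim: q {qL HP} => [|q IH].
  rewrite !expr0 mx1_mul -(@ler_pXn2r _ 2) ?nnegrE ?nrm_ge0// sqr_nrm expr1n.
  rewrite (bigD1 a)//= big1 => [|b /negPf ba]; rewrite !mxE ?eqxx.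
    by rewrite normc1 expr1n addr0.
  by rewrite ba normc0 expr0n.
rewrite exprS [leRHS]exprS mulmx_mul; apply: le_trans (Hle _) _.
by rewrite ler_wpM2l ?exprn_ge0.
Qed.

End Moments.

(** * Truncation *)

Section Truncation.
Context (R : realType).
Local Notation K := R[i].

(** Rounding towards zero, so that the norm does not increase. *)
Lemma exists_grid_point (M : nat) (x : R) : (0 < M)%N -> `|x| <= 1 ->
  exists k : 'I_(M + M).+1, let y := (k%:R - M%:R) / M%:R in
    y ^+ 2 <= x ^+ 2 /\ `|x - y| <= M%:R^-1.
Proof.
move=> M0 x1; have M0' : 0 < M%:R :> R by rewrite ltr0n.
have Mx0 : 0 <= M%:R * `|x| by rewrite mulr_ge0.
have /andP[tl tu] := truncn_itv Mx0.
set t := Num.truncn (M%:R * `|x|) in tl tu.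
have tM : (t <= M)%N.
  by rewrite -(ler_nat R); apply: le_trans tl _; rewrite ler_piMr.
have tl' : t%:R / M%:R <= `|x| by rewrite ler_pdivrMr// mulrC.
have tu' : `|x| - t%:R / M%:R <= M%:R^-1.
  rewrite -(ler_pM2l M0') mulrBr mulrCA divff ?gt_eqF// mulr1.
  by move: tu; rewrite -natr1; lra.
have t0 : 0 <= t%:R / M%:R :> R by rewrite divr_ge0.
have [x0|x0] := leP 0 x.
  have k_lt : (M + t < (M + M).+1)%N by rewrite ltnS leq_add2l.
  exists (Ordinal k_lt); rewrite /= natrD addrC addKr.
  move: tl' tu'; rewrite ger0_norm// => tl' tu'; split.
    by rewrite lerXn2r ?nnegrE.
  by rewrite ger0_norm ?subr_ge0.
have k_lt : (M - t < (M + M).+1)%N by lia.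
exists (Ordinal k_lt); rewrite /= natrB// addrAC subrr add0r mulNr.
move: tl' tu'; rewrite ltr0_norm// => tl' tu'; split.
  by rewrite sqrrN -[leRHS]sqrrN lerXn2r ?nnegrE// ltW// oppr_gt0.
by rewrite opprK ler0_norm; lra.
Qed.

Lemma normc_le_ReIm (z : K) : normc z <= `|complex.Re z| + `|complex.Im z|.
Proof.
rewrite -(@ler_pXn2r _ 2) ?nnegrE ?normc_ge0 ?addr_ge0// sqr_normc_ReIm.
rewrite -(real_normK (num_real (complex.Re z))) -(real_normK (num_real (complex.Im z))).
by rewrite sqrrD addrAC lerDl mulrn_wge0// mulr_ge0.
Qed.

Lemma exists_grid (I : finType) (e : R) : 0 < e ->
  exists (G : finType) (g : G -> I -> K), forall z : I -> K, lnorm z <= 1 ->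
    exists2 x, lnorm (g x) <= 1 & \sum_i normc (z i - g x i) <= e.
Proof.
move=> e0; pose M := (Num.truncn (2 * #|I|%:R / e)).+1.
have M0 : 0 < M%:R :> R by rewrite ltr0n.
have Me : #|I|%:R * (2 / M%:R) <= e.
  rewrite mulrA ler_pdivrMr// -ler_pdivrMl// mulrC [_ * 2]mulrC.
  exact/ltW/truncnS_gt.
pose pt (k : 'I_(M + M).+1) : R := (k%:R - M%:R) / M%:R.
exists {ffun I -> 'I_(M + M).+1 * 'I_(M + M).+1}.
exists (fun (x : {ffun I -> 'I_(M + M).+1 * 'I_(M + M).+1}) i =>
  (pt (x i).1 +i* pt (x i).2)%C) => z z1.
have zi i : normc (z i) ^+ 2 <= 1.
  have : lnorm z ^+ 2 <= 1 by rewrite expr_le1 ?lnorm_ge0.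
  rewrite sqr_lnorm (bigD1 i)//=; apply: le_trans; rewrite lerDl.
  by apply: sumr_ge0 => j _; rewrite sqr_ge0.
have small (x : R) : x ^+ 2 <= 1 -> `|x| <= 1.
  by rewrite -real_normK ?num_real// expr_le1.
have ap i : exists p : 'I_(M + M).+1 * 'I_(M + M).+1,
    [/\ pt p.1 ^+ 2 <= complex.Re (z i) ^+ 2, pt p.2 ^+ 2 <= complex.Im (z i) ^+ 2,
      `|complex.Re (z i) - pt p.1| <= M%:R^-1 &
      `|complex.Im (z i) - pt p.2| <= M%:R^-1].
  have := zi i; rewrite sqr_normc_ReIm => h.
  have [k [k1 k2]] : exists k, pt k ^+ 2 <= complex.Re (z i) ^+ 2 /\
      `|complex.Re (z i) - pt k| <= M%:R^-1.
    apply: exists_grid_point => //; apply: small; apply: le_trans h.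
    by rewrite lerDl sqr_ge0.
  have [l [l1 l2]] : exists k, pt k ^+ 2 <= complex.Im (z i) ^+ 2 /\
      `|complex.Im (z i) - pt k| <= M%:R^-1.
    apply: exists_grid_point => //; apply: small; apply: le_trans h.
    by rewrite lerDr sqr_ge0.
  by exists (k, l).
have {ap} /choice[p pP] := ap.
exists (finfun p).
  rewrite -(@ler_pXn2r _ 2) ?nnegrE ?lnorm_ge0// expr1n sqr_lnorm.
  apply: (@le_trans _ _ (lnorm z ^+ 2)); last by rewrite expr_le1 ?lnorm_ge0.
  rewrite sqr_lnorm; apply: ler_sum => i _.
  by rewrite !sqr_normc_ReIm/= ffunE; have [? ? _ _] := pP i; exact: lerD.
apply: le_trans Me; rewrite mulr_natl -sumr_const; apply: ler_sum => i _.
have -> : 2 / M%:R = M%:R^-1 + M%:R^-1 :> R by field; rewrite gt_eqF.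
apply: le_trans (normc_le_ReIm _) _; rewrite ffunE.
by have [_ _] := pP i; case: (z i) => a b /= ? ?; exact: lerD.
Qed.

Lemma bernoulli (x : R) n : 0 <= x -> 1 + n%:R * x <= (1 + x) ^+ n.
Proof.
move=> x0; elim: n => [|n IH]; first by rewrite mul0r addr0.
rewrite exprS -natr1; have n0 : 0 <= n%:R :> R by [].
have := ler_wpM2l (addr_ge0 ler01 x0) IH; nra.
Qed.

Section PowerTrick.
Context (N : nat).

(** With H = T^* T, Cauchy-Schwarz gives |H^n v|^2 = <H^(2n) v, v> <= |H^(2n) v| for
   |v| <= 1; iterate from |T v|^2 <= |H v|. *)
Lemma power_trick (T : 'M[K]_N) (v : 'cV[K]_N) r : nrm v <= 1 ->
  nrm (T *m v) ^+ (2 * 2 ^ r) <= nrm ((hadj T * T) ^+ (2 ^ r) *m v).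
Proof.
move=> v1; set H := hadj T * T.
have HX n : hadj (H ^+ n) = H ^+ n.
  elim: n => [|n IH]; first by rewrite !expr0 hadj1.
  by rewrite exprS hadjM IH /H hadjM hadjK -exprSr -exprS.
have sq (P Q : 'M[K]_N) : hadj P * P = Q -> nrm (P *m v) ^+ 2 <= nrm (Q *m v).
  move=> PQ; rewrite -dotrr dotr_hadj -mulmx_mul PQ.
  apply: le_trans (dotr_le _ _) _.
  by rewrite ler_piMl ?nrm_ge0.
elim: r => [|r IH]; first by rewrite expn0 muln1 expr1; exact: sq.
rewrite expnS mulnC exprM.
apply: (@le_trans _ _ (nrm (H ^+ (2 ^ r) *m v) ^+ 2)).
  by rewrite lerXn2r ?nnegrE ?exprn_ge0 ?nrm_ge0.
by apply: sq; rewrite HX -exprD addnn -mul2n.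
Qed.

End PowerTrick.

(** For a positive matrix B, the matrix (1 + B)^-1 damps the vectors on which the
   form of B is large, and it loses at most tr(B) of the trace of the identity. *)
Section Resolvent.
Context (N : nat) (B : 'M[K]_N).
Context (B_herm : hadj B = B) (B_ge0 : forall v : 'cV_N, 0 <= dotr (B *m v) v).

Definition resolvent : 'M[K]_N := invmx (1 + B).

Lemma resolventE (v : 'cV[K]_N) : resolvent *m v + B *m (resolvent *m v) = v.
Proof.
suff U : 1 + B \in unitmx.
  by rewrite -{1}(mx1_mul (resolvent *m v)) -mulmxDl mulmxA mulmxV// mul1mx.
rewrite -unitmx_tr -row_free_unit; apply: inj_row_free => u uB.
have Bu : (1 + B) *m u^T = 0 by rewrite -[1 + B]trmxK -trmx_mul uB trmx0.
apply: trmx_inj; rewrite trmx0; apply: nrm_eq0.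
apply/eqP; rewrite -sqrf_eq0 eq_le sqr_ge0 andbT.
have := dotr0l u^T; rewrite -Bu mulmxDl mx1_mul dotrDl dotrr => h.
by have := B_ge0 u^T; lra.
Qed.

Lemma resolvent_contraction (v : 'cV[K]_N) : nrm (resolvent *m v) <= nrm v.
Proof.
rewrite -(@ler_pXn2r _ 2) ?nnegrE ?nrm_ge0// -[in leRHS](resolventE v) sqr_nrmD.
rewrite -addrA lerDl addr_ge0 ?sqr_ge0// mulr_ge0//.
by rewrite dotrC.
Qed.

Lemma resolvent_form_le (v : 'cV[K]_N) :
  2 * dotr (B *m (resolvent *m v)) (resolvent *m v) <= nrm v ^+ 2.
Proof.
rewrite -[in leRHS](resolventE v) sqr_nrmD dotrC.
by have := sqr_ge0 (nrm (resolvent *m v)); have := sqr_ge0 (nrm (B *m (resolvent *m v))); lra.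
Qed.

(** Expanding [0 <= <(1 + B) x, x>] at [x = resolvent v - v]. *)
Lemma resolvent_form_ge (v : 'cV[K]_N) : nrm v ^+ 2 - dotr (B *m v) v <= dotr (resolvent *m v) v.
Proof.
have := resolventE v; set w := resolvent *m v => wE.
have := sqr_ge0 (nrm (w - v)); have := B_ge0 (w - v).
rewrite -[nrm (w - v) ^+ 2]dotrr mulmxBr !dotrDl !dotrDr !dotrNl !dotrNr.
have -> : dotr (B *m v) w = dotr (B *m w) v.
  by rewrite dotrC dotr_hadj B_herm.
have := congr1 (fun x => dotr x w) wE; have := congr1 (fun x => dotr x v) wE.
rewrite !dotrDl dotrr [dotr v w]dotrC !dotrr.
set x1 := dotr (B *m w) w; set x2 := dotr (B *m w) v; set x3 := dotr w v.
by lra.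
Qed.

End Resolvent.

Lemma dotr_delta N (M : 'M[K]_N) a :
  dotr (M *m delta_mx a 0) (delta_mx a 0) = complex.Re (M a a).
Proof.
rewrite /dotr (bigD1 a)//= big1 => [|b /negPf ba].
  by rewrite -colE !mxE !eqxx rmorph1 mulr1 addr0.
by rewrite [delta_mx a 0 b 0]mxE ba rmorph0 mulr0.
Qed.

Lemma nrm_delta N (a : 'I_N) : nrm (delta_mx a 0 : 'cV[K]_N) = 1.
Proof.
apply/eqP; rewrite -(@eqrXn2 _ 2) ?nrm_ge0// expr1n -dotrr -[delta_mx a 0 in X in dotr X _]mx1_mul.
by rewrite dotr_delta mxE eqxx.
Qed.

(** The constants 5/4 and 15/16 only have to satisfy (5/4) / (15/16) = 4/3; they
   leave room for the factor 9/8 lost by the moments of order 4q and for the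
   distance 1/8 to the net. *)
Lemma truncation d m : exists N (sg : 'I_d * 'I_m -> 'I_N -> 'I_N) (Q : 'M[K]_N),
  [/\ (0 < N)%N, forall s, involutive (sg s),
    forall (z : {ffun 'I_d -> 'I_m} -> K) (v : 'cV_N),
      nrm (combination sg pair z *m (Q *m v)) <=
        5 / 4 * d.+1%:R * lnorm z * nrm v &
    15 / 16 * N%:R <= complex.Re (\tr Q)].
Proof.
have [G [g gP]] := @exists_grid {ffun 'I_d -> 'I_m} (1 / 8) ltac:(lra).
(* A power of two, for [power_trick], so large that (9/8)^(4q) absorbs
   the number of points of the grid. *)
pose q := (2 ^ (64 * #|G|.+1))%N.
have qG : 8 * #|G|.+1%:R <= (9 / 8) ^+ (4 * q) :> R.
  rewrite (_ : 9 / 8 = 1 + 1 / 8); last by lra.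
  apply: le_trans (bernoulli _ (_ : 0 <= 1 / 8)); last by lra.
  have : (64 * #|G|.+1 <= 4 * q)%N.
    by apply: leq_trans (ltnW (ltn_expl _ (ltnSn 1))) _; rewrite leq_pmull.
  by rewrite -(ler_nat R) !natrM; lra.
pose c : R := d.+1%:R.
have c0 : 0 < c by rewrite ltr0n.
have [N [sg [N0 sg_free]]] := exists_locally_free ('I_d * 'I_m)%type (q * (d + d)).
pose T z := combination sg pair z : 'M[K]_N.
pose H z := hadj (T z) * T z.
(* The normalization for which B has trace at most N / 16. *)
pose k : R := (16 * #|G|.+1%:R * c ^+ (4 * q))^-1.
have k0 : 0 < k by rewrite invr_gt0 !mulr_gt0// ?ltr0n// exprn_gt0.
pose B : 'M[K]_N := k%:C *: \sum_(x | lnorm (g x) <= 1) hadj (H (g x) ^+ q) * H (g x) ^+ q.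
have Bform (v : 'cV[K]_N) : dotr (B *m v) v =
    k * \sum_(x | lnorm (g x) <= 1) nrm (H (g x) ^+ q *m v) ^+ 2.
  rewrite -scalemxAl dotrZl mulmx_suml dotr_suml; congr (_ * _).
  by apply: eq_bigr => x _; rewrite mulmx_mul dotr_hadj hadjK dotrr.
have B_ge0 (v : 'cV[K]_N) : 0 <= dotr (B *m v) v.
  by rewrite Bform mulr_ge0 ?(ltW k0)// sumr_ge0// => x _; rewrite sqr_ge0.
have B_herm : hadj B = B.
  rewrite hadjZ conjc_real hadj_sum; congr (_ *: _); apply: eq_bigr => x _.
  by rewrite hadjM hadjK.
have lpair : letters (pair : 'I_d -> 'I_m -> 'I_d * 'I_m) by move=> ? ? ? ? [-> ->].
pose Q := resolvent B; exists N, sg, Q.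
have Qc := resolvent_contraction B_ge0.
have onlettered (v : 'cV[K]_N) i : nrm (letter_word R sg pair i *m v) = nrm v.
  exact: (nrm_letter_word sg_free).
split=> //; first exact: sg_free.1.
  (* On the range of [Q], a bound for the points of the grid. *)
  have grid_le x (v : 'cV[K]_N) : lnorm (g x) <= 1 -> nrm v <= 1 ->
      nrm (T (g x) *m (Q *m v)) <= 9 / 8 * c.
    move=> x1 v1; have q0 : (0 < 2 * q * 2)%N by rewrite !muln_gt0 expn_gt0.
    have c98 : 0 <= 9 / 8 * c by lra.
    rewrite -(@ler_pXn2r _ (2 * q * 2)) ?nnegrE ?nrm_ge0// exprM.
    apply: (@le_trans _ _ (nrm (H (g x) ^+ q *m (Q *m v)) ^+ 2)).
      rewrite lerXn2r ?nnegrE ?exprn_ge0 ?nrm_ge0//; apply: power_trick.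
      exact: le_trans (Qc v) v1.
    rewrite exprMn (_ : 2 * q * 2 = 4 * q)%N; last by lia.
    have h : 2 * (k * nrm (H (g x) ^+ q *m (Q *m v)) ^+ 2) <= 1.
      apply: (@le_trans _ _ (nrm v ^+ 2)); last by rewrite expr_le1 ?nrm_ge0.
      apply: le_trans (resolvent_form_le B_ge0 v); rewrite ler_wpM2l//.
      rewrite Bform (bigD1 x)//= mulrDr lerDl mulr_ge0 ?(ltW k0)//.
      by apply: sumr_ge0 => y _; rewrite sqr_ge0.
    apply: (@le_trans _ _ (8 * #|G|.+1%:R * c ^+ (4 * q))); last first.
      by rewrite ler_wpM2r// exprn_ge0 ?(ltW c0).
    move: h; rewrite mulrCA ler_pdivrMl ?mulr_gt0 ?ltr0n ?exprn_gt0// mulr1.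
    set X := nrm _ ^+ 2; set Y := c ^+ _; set Z := _%:R; lra.
  have unit_le z (v : 'cV[K]_N) : lnorm z <= 1 -> nrm v <= 1 -> nrm (T z *m (Q *m v)) <= 5 / 4 * c.
    move=> z1 v1; have [x x1 zx] := gP z z1.
    have -> : T z *m (Q *m v) = T (g x) *m (Q *m v) +
        \sum_i (z i - g x i) *: (letter_word R sg pair i *m (Q *m v)).
      rewrite /T /combination !mulmx_suml -big_split/=; apply: eq_bigr => i _.
      by rewrite -!scalemxAl -scalerDl addrC subrK.
    have -> : 5 / 4 * c = 9 / 8 * c + 1 / 8 * c by lra.
    apply: le_trans (nrmD _ _) _; apply: lerD; first exact: grid_le.
    apply: (@le_trans _ _ (1 / 8)); last by have : 1 <= c; [rewrite ler1n | lra].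
    apply: le_trans zx; apply: le_trans (nrm_sum _) _; apply: ler_sum => i _.
    rewrite nrmZ onlettered ler_piMr ?normc_ge0//.
    exact: le_trans (Qc v) v1.
  move=> z v.
  have [z0|z0] := eqVneq (lnorm z) 0.
    rewrite z0 mulr0 mul0r (_ : combination _ _ _ = 0) ?mul0mx ?nrm0//.
    apply: big1 => i _; rewrite (_ : z i = 0) ?scale0r//; apply: eq0_normc.
    have := sqr_lnorm z; rewrite z0 expr0n/= => /esym/eqP.
    rewrite psumr_eq0 => [/allP/(_ i (mem_index_enum i))|j _]; last by rewrite sqr_ge0.
    by rewrite sqrf_eq0 => /eqP.
  have [v0|v0] := eqVneq (nrm v) 0.
    by rewrite (nrm_eq0 v0) !mulmx0 nrm0 mulr0.
  have {}z0 : 0 < lnorm z by rewrite lt_neqAle eq_sym z0 lnorm_ge0.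
  have {}v0 : 0 < nrm v by rewrite lt_neqAle eq_sym v0 nrm_ge0.
  have := unit_le (fun i => (lnorm z)^-1%:C * z i) ((nrm v)^-1%:C *: v).
  have -> : lnorm (fun i => (lnorm z)^-1%:C * z i) = 1.
    apply/eqP; rewrite -(@eqrXn2 _ 2) ?lnorm_ge0// expr1n sqr_lnorm.
    under eq_bigr do rewrite normcM normc_real ?invr_ge0 ?lnorm_ge0// exprMn.
    by rewrite -mulr_sumr -sqr_lnorm -exprMn mulVf ?expr1n// gt_eqF.
  rewrite nrmZ normc_real ?invr_ge0 ?nrm_ge0// mulVf ?gt_eqF// lexx.
  move=> /(_ isT isT).
  have -> : T (fun i => (lnorm z)^-1%:C * z i) = (lnorm z)^-1%:C *: T z.
    by rewrite /T /combination scaler_sumr; apply: eq_bigr => i _; rewrite scalerA.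
  rewrite -!scalemxAr -scalemxAl !nrmZ !normc_real ?invr_ge0 ?nrm_ge0 ?lnorm_ge0//.
  rewrite mulrCA !ler_pdivrMl// /c => h; apply: le_trans h _.
  by rewrite le_eqVlt; apply/orP; left; apply/eqP; ring.
rewrite /mxtrace raddf_sum/=.
rewrite mulr_natr -[X in _ *+ X]card_ord -sumr_const; apply: ler_sum => a _.
rewrite -dotr_delta.
apply: le_trans (resolvent_form_ge B_herm B_ge0 _); rewrite nrm_delta expr1n Bform.
suff : k * \sum_(x | lnorm (g x) <= 1) nrm (H (g x) ^+ q *m delta_mx a 0) ^+ 2 <= 1 / 16 by lra.
apply: (@le_trans _ _ (k * (#|G|.+1%:R * c ^+ (4 * q)))); last first.
  rewrite /k ler_pdivrMl ?mulr_gt0 ?ltr0n ?exprn_gt0//.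
  by set Y := c ^+ _; set Z := _%:R; lra.
rewrite ler_wpM2l ?(ltW k0)//.
apply: (@le_trans _ _ (\sum_(x : G) c ^+ (4 * q))).
  rewrite big_mkcond/=; apply: ler_sum => x _; case: ifP => x1; last first.
    by rewrite exprn_ge0 ?(ltW c0).
  rewrite (_ : 4 * q = 2 * q * 2)%N; last by lia.
  rewrite exprM lerXn2r ?nnegrE ?nrm_ge0 ?exprn_ge0 ?(ltW c0)//.
  exact: (moment_le sg_free a lpair (leqnn _) x1).
rewrite sumr_const -[leLHS]mulr_natl ler_wpM2r ?exprn_ge0 ?(ltW c0)//.
by rewrite ler_nat leqnSn.
Qed.

End Truncation.

(** * The lower estimate *)

Section MatrixOperators.
Context (R : realType) (N : nat).
Local Notation K := R[i].
Local Notation ell2 := (ell2 R).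
Local Notation bop := (bop R).

(** Operators on the span of the first N basis vectors. *)
Definition pad_fun (v : 'cV[K]_N) (n : nat) : K :=
  if insub n is Some a then v a 0 else 0.

Lemma pad_funE v (a : 'I_N) : pad_fun v a = v a 0.
Proof. by rewrite /pad_fun valK. Qed.

Lemma sqsum_pad_le v n : sqsum (pad_fun v) n <= nrm v ^+ 2.
Proof.
apply: le_trans (sqsum_nd (pad_fun v) (leq_addl N n)) _.
have tail_eq0 : \sum_(N <= k < N + n) normc (pad_fun v k) ^+ 2 = 0.
  rewrite big_nat big1// => k /andP[Nk _].
  by rewrite /pad_fun insubF ?normc0 ?expr0n//; apply/negbTE; rewrite -leqNgt.
rewrite sqsumE (big_cat_nat (n := N)) ?leq_addr//= tail_eq0 addr0 big_mkord sqr_nrm.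
by apply: ler_sum => a _; rewrite pad_funE.
Qed.

Definition pad v : ell2 := ell2_of (sqsum_pad_le v).

Definition coords (u : ell2) : 'cV[K]_N := \col_a u a.

Lemma l2norm_pad v : l2norm (pad v) <= nrm v.
Proof. by apply: l2norm_le; [exact: nrm_ge0 | exact: sqsum_pad_le]. Qed.

Lemma nrm_coords u : nrm (coords u) <= l2norm u.
Proof.
rewrite -(@ler_pXn2r _ 2) ?nnegrE ?nrm_ge0 ?l2norm_ge0// sqr_nrm.
apply: le_trans (sqsum_le u N); rewrite sqsumE big_mkord.
by apply: ler_sum => a _; rewrite mxE.
Qed.

Definition mxop_fun (M : 'M[K]_N) (u : ell2) : ell2 := pad (M *m coords u).

Lemma mxop_linear M : linear (mxop_fun M).
Proof.
move=> c u v; apply: ell2P => n; rewrite ell2DE ell2ZE /= /pad_fun.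
have -> : coords (c *: u + v) = c *: coords u + coords v.
  by apply/matrixP => a b; rewrite !mxE.
rewrite mulmxDr -scalemxAr; case: insub => [a|]; first by rewrite !mxE.
by rewrite mulr0 addr0.
Qed.

Lemma mxop_bounded M u :
  l2norm (mxop_fun M u) <= Num.sqrt (\sum_b nrm (col b M) ^+ 2) * l2norm u.
Proof.
apply: le_trans (l2norm_pad _) _.
have -> : M *m coords u = \sum_b coords u b 0 *: col b M.
  by apply/matrixP => a j; rewrite ord1 summxE mxE; apply: eq_bigr => b _; rewrite !mxE mulrC.
apply: (@le_trans _ _ (nrm (coords u) * Num.sqrt (\sum_b nrm (col b M) ^+ 2))).
  apply: nrm_sum_scale_le; rewrite ?sqrtr_ge0// sqr_sqrtr//.
  by apply: sumr_ge0 => b _; rewrite sqr_ge0.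
by rewrite mulrC ler_wpM2l ?sqrtr_ge0// nrm_coords.
Qed.

Definition mxop M : bop := bop_of (@mxop_linear M) (@mxop_bounded M).

Lemma mxop_entry M (a b : 'I_N) : mxop M (unit_vec R b) a = M a b.
Proof.
rewrite [LHS]pad_funE mxE (bigD1 b)//= big1 => [|c cb].
  by rewrite mxE unit_vecE eqxx mulr1 addr0.
by rewrite mxE unit_vecE val_eqE (negPf cb) mulr0.
Qed.

Lemma opnorm_sum_mxop_le (I : finType) (z : I -> K) (M : I -> 'M[K]_N) (c : R) :
  0 <= c -> (forall v : 'cV_N, nrm ((\sum_i z i *: M i) *m v) <= c * nrm v) ->
  opnorm (\sum_i z i *: mxop (M i)) <= c.
Proof.
move=> c0 Mc; apply: opnorm_le_of => // u.
have -> : (\sum_i z i *: mxop (M i)) u = pad ((\sum_i z i *: M i) *m coords u).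
  apply: ell2P => n; rewrite bop_sumE ell2_sumE.
  rewrite -[RHS]/(pad_fun ((\sum_i z i *: M i) *m coords u) n) /pad_fun.
  case: insubP => [a _ an|nN].
    rewrite mulmx_suml summxE; apply: eq_bigr => i _.
    by rewrite bopZE ell2ZE -an [mxop _ _ _]pad_funE -scalemxAl [RHS]mxE.
  apply: big1 => i _; rewrite bopZE ell2ZE /= /pad_fun insubF ?mulr0//.
  exact/negbTE.
apply: le_trans (l2norm_pad _) _; apply: le_trans (Mc _) _.
by rewrite ler_wpM2l// nrm_coords.
Qed.

End MatrixOperators.

Section LowerEstimate.
Context (R : realType) (m : nat) (m_gt0 : (0 < m)%N).
Local Notation K := R[i].
Local Notation bop := (bop R).

Lemma letter_word_trans (S : finType) N (sg : S -> 'I_N -> 'I_N) d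
    (l : 'I_d -> 'I_m -> S) i (v : 'cV[K]_N) a :
  (letter_word R sg l i *m v) a 0 = v (trans (fun k j => sg (l k j)) i a) 0.
Proof.
elim: d l i a => [|d IH] l i a; first by rewrite /letter_word mono0 mx1_mul.
rewrite (fcons_surj i) /letter_word mono_fcons mulmx_mul shuffleE trans_fcons.
exact: (IH (fun k => l (lift ord0 k))).
Qed.

Lemma trans_inj N d (s : 'I_d -> 'I_m -> 'I_N -> 'I_N) i :
  (forall k j, injective (s k j)) -> injective (trans s i).
Proof.
elim: d s i => [|d IH] s i si; first by [].
rewrite (fcons_surj i) => a b; rewrite !trans_fcons.
by move=> /(IH _ _ (fun k => si (lift ord0 k)))/si.
Qed.

Lemma normc_unimodular (z : K) : z * z^*%C = 1 -> normc z = 1.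
Proof.
move=> z1; apply/eqP; rewrite -(@eqrXn2 _ 2) ?normc_ge0// expr1n.
by have := sqr_normc_conj z; rewrite z1 => -[->].
Qed.

(** The family conj(phi(i)) U_i Q / c, with c = (5/4)(d+2) for words of length d+1. *)
Lemma hard_family d : exists x : {ffun 'I_d.+1 -> 'I_m} -> bop,
  l2_dominated x /\
  forall (A C : R), 0 < A -> A ^+ 2 = m%:R ^+ d -> 0 <= C -> factorizes C x ->
    3 / 4 / d.+2%:R * A <= C.
Proof.
have [w w_prim] := exists_prim_root R m_gt0.
have [N [sg [Q [N0 sgK Qle trQ]]]] := truncation R d.+1 m.
set c : R := 5 / 4 * d.+2%:R in Qle.
have c0 : 0 < c by rewrite mulr_gt0 ?ltr0n//; lra.
pose ph (i : {ffun 'I_d.+1 -> 'I_m}) := phase w (i ord0) [ffun k : 'I_d => i (lift ord0 k)].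
have phE j i : ph (fcons j i) = phase w j i.
  rewrite /ph fcons0; congr phase.
  by apply/ffunP => k; rewrite ffunE fconsS.
have ph1 i : ph i * (ph i)^*%C = 1 by exact: phase_conj.
pose co i : K := (ph i)^*%C * (c^-1)%:C.
have nco i : normc (co i) = c^-1.
  rewrite normcM normc_real ?invr_ge0 ?(ltW c0)// normc_unimodular ?mul1r//.
  by rewrite conjcK mulrC.
pose x i := mxop (co i *: (letter_word R sg pair i * Q)).
exists x; split.
  move=> z; apply: opnorm_sum_mxop_le => [|v]; first exact: sqrtr_ge0.
  have -> : (\sum_i z i *: (co i *: (letter_word R sg pair i * Q))) *m v =
      combination sg pair (fun i => z i * co i) *m (Q *m v).
    rewrite -mulmx_mul /combination mulr_suml; congr (_ *m _).
    by apply: eq_bigr => i _; rewrite scalerA -!mulmxE scalemxAl.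
  apply: le_trans (Qle _ _) _; rewrite ler_wpM2r ?nrm_ge0//.
  have -> : lnorm (fun i => z i * co i) = c^-1 * lnorm z.
    apply/eqP; rewrite -(@eqrXn2 _ 2) ?mulr_ge0 ?invr_ge0 ?(ltW c0) ?lnorm_ge0//.
    rewrite exprMn !sqr_lnorm mulr_sumr; apply/eqP/eq_bigr => i _.
    by rewrite normcM nco exprMn mulrC.
  by rewrite mulrA divff ?mul1r// gt_eqF.
move=> A C A0 Am C0 [y [y1 xy]].
pose s k j := sg (k, j) : 'I_N -> 'I_N.
have s_inj k j : injective (s k j) by exact: inv_inj (sgK _).
have := phase_sum_le w_prim y1 s_inj.
set G := \sum_j _ => Gle.
(* The phases of the family cancel those of the sum, and the permutations
     only move the diagonal entries of [Q] around. *)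
have CG : C%:C * G = (m%:R ^+ d.+1 * c^-1)%:C * \tr Q.
  have trE i : \tr Q = \sum_a Q (trans s i a) (trans s i a).
    by rewrite /mxtrace (reindex_inj (@trans_inj _ _ s i s_inj)).
  rewrite /G mulr_sumr.
  under eq_bigr do rewrite exchange_big mulr_sumr/=.
  rewrite [LHS](_ : _ = \sum_(j < m) \sum_(i : {ffun 'I_d -> 'I_m}) (c^-1)%:C * \tr Q).
    rewrite pair_bigA/= sumr_const card_prod card_ffun !card_ord -expnS.
    by rewrite -[LHS]mulr_natl natrX mulrA [in RHS]rmorphM [in RHS]rmorphXn [in RHS]rmorph_nat.
  apply: eq_bigr => j _.
  apply: eq_bigr => i _; rewrite (trE (fcons j i)) !mulr_sumr.
  apply: eq_bigr => a _; set b := trans s _ a.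
  have -> : C%:C * (phase w j i * word y (fcons j i) (unit_vec R b) a) =
      ph (fcons j i) * (x (fcons j i) (unit_vec R b) a).
    by rewrite phE xy bopZE ell2ZE mulrCA.
  rewrite mxop_entry mxE -mulmxE /co mulrA mulrA ph1 mul1r; congr (_ * _).
  transitivity ((letter_word R sg pair (fcons j i) *m col b Q) a 0).
    by rewrite !mxE; apply: eq_bigr => e _; rewrite !mxE.
  by rewrite letter_word_trans mxE.
have normG : normc G <= N%:R * (m%:R * A).
  rewrite -(@ler_pXn2r _ 2) ?nnegrE ?normc_ge0 ?mulr_ge0 ?(ltW A0)//.
  by apply: le_trans Gle _; rewrite !exprMn Am -exprD.
have : m%:R ^+ d.+1 * c^-1 * (15 / 16 * N%:R) <= C * normc G.
  rewrite -[X in X * normc G]normc_real// -normcM CG normcM normc_real; last first.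
    by rewrite mulr_ge0 ?exprn_ge0 ?invr_ge0 ?(ltW c0).
  rewrite ler_wpM2l ?mulr_ge0 ?exprn_ge0 ?invr_ge0 ?(ltW c0)//.
  apply: le_trans trQ _; apply: le_trans (ler_norm _) _.
  by have := normc_ge_Re (\tr Q); rewrite normC_normc lecR.
move=> /le_trans/(_ (ler_wpM2l C0 normG)).
have m0 : 0 < m%:R :> R by rewrite ltr0n.
have N0' : 0 < N%:R :> R by rewrite ltr0n.
rewrite exprS -Am.
have -> : m%:R * A ^+ 2 / c * (15 / 16 * N%:R) = (N%:R * (m%:R * A)) * (3 / 4 / d.+2%:R * A).
  have : d.+2%:R != 0 :> R by rewrite pnatr_eq0.
  by rewrite /c; set Z := d.+2%:R => Z0; field.
by rewrite [C * _]mulrC ler_pM2l// !mulr_gt0.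
Qed.

Lemma hard_family1 : exists x : {ffun 'I_1 -> 'I_m} -> bop,
  l2_dominated x /\ forall C : R, 0 <= C -> factorizes C x -> 1 <= C.
Proof.
pose i0 : {ffun 'I_1 -> 'I_m} := [ffun=> Ordinal m_gt0].
pose x i : bop := if i == i0 then 1 else 0; exists x; split.
  move=> z; rewrite (bigD1 i0)//= [X in _ + X]big1 => [|i /negPf ii0]; last first.
    by rewrite /x ii0 scaler0.
  rewrite /x eqxx addr0; apply: le_trans (ler_opnormZ _ _) _.
  apply: (@le_trans _ _ (normc (z i0))).
    by rewrite ler_piMr ?normc_ge0 ?opnorm1_le1.
  rewrite -[leLHS]ger0_norm ?normc_ge0// -sqrtr_sqr ler_wsqrtr// (bigD1 i0)//= lerDl.
  by apply: sumr_ge0 => i _; rewrite sqr_ge0.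
move=> C C0 [y [y1 xy]]; have := congr1 (fun T : bop => l2norm (T (unit_vec R 0))) (xy i0).
rewrite /x eqxx bopZE l2normZ normc_real// l2norm_unit_vec => ->.
rewrite ler_piMr//; apply: le_trans (contraction_l2norm _ _) _.
  exact: opnorm_word_le1.
by rewrite l2norm_unit_vec.
Qed.

End LowerEstimate.

Lemma pow4_ge d : (0 < d)%N -> (4 * d.+2 <= 3 * 4 ^ d)%N.
Proof. by case: d => // d _; elim: d => // d IH; rewrite expnS; lia. Qed.

Theorem theorem0p2 (R : realType) (m d : nat) (hm : (1 <= m)%N) (hd : (1 <= d)%N) :
  [/\ ((2 ^- (2 * d.-1) * m%:R `^ (d.-1%:R / 2))%:E
         <= factorization_constant' R m d)%E,
      (factorization_constant' R m d <= factorization_constant R m d)%E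
    & (factorization_constant R m d <= (m%:R `^ (d.-1%:R / 2))%:E)%E].
Proof.
case: d hd => // d _; rewrite [d.+1.-1]/=.
set A := m%:R `^ (d%:R / 2) : R.
have A0 : 0 < A by apply: powR_gt0; rewrite ltr0n.
have Am : A ^+ 2 = m%:R ^+ d.
  by rewrite -powR_mulrn ?(ltW A0)// -powRrM divfK ?pnatr_eq0// powR_mulrn.
split.
- apply: le_ereal_inf_tmp => _ [C [C0 HC] <-]; rewrite lee_fin.
  case: d @A A0 Am HC => [|d] A A0 Am HC.
    have [x [xl /(_ C C0 (HC x xl))]] := hard_family1 R hm.
    apply: le_trans; rewrite muln0 expr0 invr1 mul1r.
    by rewrite -(@ler_pXn2r _ 2) ?nnegrE ?(ltW A0)// Am expr0 expr1n.
  have [x [xl /(_ A C A0 Am C0 (HC x xl))]] := hard_family R hm d.+1.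
  apply: le_trans; rewrite ler_wpM2r ?(ltW A0)// exprM.
  have p0 : 0 < (2 ^+ 2) ^+ d.+1 :> R by rewrite exprn_gt0.
  rewrite -[_^-1]mul1r ler_pdivrMr// mulrAC ler_pdivlMr ?ltr0n// mul1r.
  have := pow4_ge (ltn0Sn d); rewrite -(ler_nat R) !natrM natrX.
  rewrite -[2 ^+ 2]/(2 * 2 : R) (_ : 2 * 2 = 4 :> R); last by lra.
  by set X := 4 ^+ _; set Y := d.+3%:R; lra.
- apply: ereal_inf_le_tmp => _ [C [C0 HC] <-]; exists C => //; split=> // x xl.
  by apply: HC; exact: l2_dominated_triple.
- apply: ge_ereal_inf; exists A%:E => //; exists A => //; split; first exact: ltW.
  move=> x xt; apply: factorizes_contractions => // i.
  exact: triple_norm_dominated_contraction.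
Qed.
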